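(* Let $N\ge 2$, $1\le k<N$, and let $\Omega\subset\mathbb{R}^N$ be a bounded domain. Let $H:\Omega\times\mathbb{R}^N\to\mathbb{R}$ be continuous and such that $$H(x,t\xi)=tH(x,\xi)\qquad\forall (x,t,\xi)\in\Omega\times\mathbb{R}_+\times\mathbb{R}^N,$$ and such that there is a modulus of continuity $\omega$ with $$|H(x,\xi)-H(y,\xi)|\le\omega\big(|x-y|(1+|\xi|)\big)\qquad\forall x,y\in\Omega,\ \xi\in\mathbb{R}^N.$$ Then the operator $u\mapsto\mathcal{P}^-_k(D^2u)+H(x,\nabla u)+\mu u$ satisfies (i) the minimum principle in $\Omega$ for $\mu<\overline{\mu}_k^-$; (ii) the maximum principle in $\Omega$ for $\mu<\overline{\mu}_k^+$.
   Context: For a real symmetric $N\times N$ matrix $X$ with ordered eigenvalues $\lambda_1(X)\le\cdots\le\lambda_N(X)$, $\mathcal{P}^-_k(X)=\sum_{i=1}^k\lambda_i(X)$. A modulus of continuity is a nondecreasing function $\omega:[0,\infty)\to[0,\infty)$ with $\omega(s)\to 0=\omega(0)$ as $s\to 0^+$. Viscosity sense: a real-valued $u$ is a subsolution, $F(x,u,\nabla u,D^2u)\ge 0$ (resp. supersolution, $F(x,u,\nabla u,D^2u)\le 0$) in $\Omega$ if it is upper (resp. lower) semicontinuous and, for every $x\in\Omega$ and every $C^2$ function $\varphi$ touching $u$ from above (resp. below) at $x$, $F(x,u(x),\nabla\varphi(x),D^2\varphi(x))\ge 0$ (resp. $\le 0$). Write $F[u]=F(x,u,\nabla u,D^2u)$.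 Maximum principle in $\Omega$: $F[u]\ge 0$ in $\Omega$ and $\limsup_{x\to\partial\Omega}u\le 0$ imply $u\le 0$ in $\Omega$. Minimum principle in $\Omega$: $F[u]\le 0$ in $\Omega$ and $\liminf_{x\to\partial\Omega}u\ge 0$ imply $u\ge 0$ in $\Omega$. For the equation (E$_\mu$): $\mathcal{P}^-_k(D^2u)+H(x,\nabla u)+\mu u=0$ in $\Omega$, define $\overline{\mu}_k^+=\sup\{\mu\in\mathbb{R}:\ \exists\, w>0\text{ in }\overline\Omega\text{ a supersolution of (E}_\mu)\}$ and $\overline{\mu}_k^-=\sup\{\mu\in\mathbb{R}:\ \exists\, w<0\text{ in }\overline\Omega\text{ a subsolution of (E}_\mu)\}$, where $w$ is a real-valued function on $\overline\Omega$, lower semicontinuous on $\overline\Omega$ in the definition of $\overline{\mu}_k^+$ and upper semicontinuous on $\overline\Omega$ in the definition of $\overline{\mu}_k^-$. *)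

(* Defs.v *)
From HB Require Import structures.
From mathcomp Require Import all_boot all_order all_algebra.
From mathcomp Require Import all_classical all_reals all_analysis.
From mathcomp Require sesquilinear spectral complex.

Set Implicit Arguments.
Unset Strict Implicit.
Unset Printing Implicit Defensive.

Import Order.TTheory GRing.Theory Num.Theory.
Import numFieldNormedType.Exports.
Local Open Scope classical_set_scope.
Local Open Scope ring_scope.

(* The library norm on ['rV[R]_N] is the sup norm: it induces the usual topology
   and bounded sets, but is not the Euclidean |x|. *)
Definition enorm (R : realType) (N : nat) (x : 'rV[R]_N) : R :=
  Num.sqrt (\sum_(i < N) x 0 i ^+ 2).

(* Eigenvalues with multiplicity in nondecreasing order; [eigvals X] is
   meaningful when the characteristic polynomial of [X] splits over [R], in
   particular for symmetric [X], see [eigvals_sym]. *)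
Definition is_eigvals (R : realType) (N : nat) (X : 'M[R]_N) (s : seq R) : Prop :=
  sorted <=%R s /\ char_poly X = \prod_(a <- s) ('X - a%:P).

Definition eigvals (R : realType) (N : nat) (X : 'M[R]_N) : seq R :=
  xget [::] [set s | is_eigvals X s].

Definition Pminus (R : realType) (N k : nat) (X : 'M[R]_N) : R :=
  \sum_(i < k) (eigvals X)`_i.

Lemma is_eigvals_unique (R : realType) (N : nat) (X : 'M[R]_N) (s t : seq R) :
  is_eigvals X s -> is_eigvals X t -> s = t.
Proof.
move=> [ss es] [st et].
apply: (sorted_eq (@le_trans _ _) (@le_anti _ _) ss st).
apply: prod_XsubC_eq; by rewrite -es -et.
Qed.

Section SymSplit.
Import sesquilinear spectral complex.

Lemma char_poly_sym_split (R : realType) (N : nat) (X : 'M[R]_N) :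
  X^T = X -> exists s : seq R, char_poly X = \prod_(a <- s) ('X - a%:P).
Proof.
move=> Xs.
pose f : {rmorphism R -> complex R} := real_complex_def (Phant R).
pose A := map_mx f X.
have Areal : A \is a mxOver Num.real.
  apply/mxOverP => i j; rewrite mxE; apply/complex_realP.
  by exists (X i j).
have Aherm : A \is hermitianmx _ false Num.conj.
  apply: realsym_hermsym => //.
  by apply/is_hermitianmxP; rewrite expr0 scale1r map_mx_id// /A map_trmx Xs.
have Adiag := hermitian_spectral_diag_real Aherm.
have /hermitian_normalmx/orthomx_spectralP Aeq := Aherm.
set P := spectralmx A in Aeq.
set D := spectral_diag A in Aeq Adiag.
have Pu : P \in unitmx := spectral_unit A.
exists [seq complex.Re (D 0 i) | i <- enum 'I_N].
apply: (map_inj_poly (@complexI R) (rmorph0 f)).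
rewrite (map_char_poly f) -/A map_prod_XsubC big_map big_enum /=.
have -> : char_poly A = char_poly (diag_mx D).
  have PV : 1%:M = map_mx polyC (invmx P) *m map_mx polyC P.
    by rewrite -map_mxM mulVmx// map_mx1.
  rewrite /char_poly [in LHS]Aeq.
  have -> : char_poly_mx (invmx P *m diag_mx D *m P) =
      map_mx polyC (invmx P) *m char_poly_mx (diag_mx D) *m map_mx polyC P.
    rewrite /char_poly_mx mulmxBr mulmxBl !map_mxM /= scalar_mxC.
    by rewrite -[X in _ = X - _]mulmxA -PV mulmx1.
  by rewrite !det_mulmx mulrAC -det_mulmx -PV det1 mul1r.
rewrite char_poly_trig ?diag_mx_is_trig//.
apply: eq_bigr => i _; rewrite mxE eqxx mulr1n.
by rewrite /= RRe_real//; exact: (mxOverP Adiag).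
Qed.

End SymSplit.

Lemma eigvals_sym (R : realType) (N : nat) (X : 'M[R]_N) :
  X^T = X -> is_eigvals X (eigvals X) /\ size (eigvals X) = N.
Proof.
move=> Xs.
have H : is_eigvals X (eigvals X).
  rewrite /eigvals; apply: (@xgetPex _ [::] [set s | is_eigvals X s]) => /=.
  have [d Xd] := char_poly_sym_split Xs.
  exists (sort <=%R d); split; first exact: (sort_sorted (@le_total _ _)).
  by rewrite Xd; apply: perm_big; rewrite perm_sym perm_sort.
split => //; case: H => _ /(congr1 (fun p : {poly R} => size p)).
by rewrite size_char_poly size_prod_XsubC => -[].
Qed.

Definition partial (R : realType) (N : nat) (i : 'I_N)
    (phi : 'rV[R]_N -> R) (x : 'rV[R]_N) : R :=
  'D_(delta_mx 0 i) phi x.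

Definition grad (R : realType) (N : nat) (phi : 'rV[R]_N -> R)
    (x : 'rV[R]_N) : 'rV[R]_N :=
  \row_(i < N) partial i phi x.

Definition hess (R : realType) (N : nat) (phi : 'rV[R]_N -> R)
    (x : 'rV[R]_N) : 'M[R]_N :=
  \matrix_(i < N, j < N) partial j (partial i phi) x.

Definition C1_on (R : realType) (N : nat) (U : set 'rV[R]_N)
    (phi : 'rV[R]_N -> R) : Prop :=
  (forall x, U x -> {for x, continuous phi}) /\
  forall (i : 'I_N) x, U x ->
    derivable phi x (delta_mx 0 i) /\ {for x, continuous (partial i phi)}.

Definition C2_on (R : realType) (N : nat) (U : set 'rV[R]_N)
    (phi : 'rV[R]_N -> R) : Prop :=
  C1_on U phi /\ forall i : 'I_N, C1_on U (partial i phi).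

(* Points outside [A] are isolated in [subspace A], so only [u] on [A] matters. *)
Definition lsc_on (R : realType) (N : nat) (A : set 'rV[R]_N)
    (u : 'rV[R]_N -> R) : Prop :=
  lower_semicontinuous (fun y : subspace A => (u y)%:E).

Definition usc_on (R : realType) (N : nat) (A : set 'rV[R]_N)
    (u : 'rV[R]_N -> R) : Prop :=
  lsc_on A (fun y => - u y).

Definition touches_above (R : realType) (N : nat) (phi u : 'rV[R]_N -> R)
    (x : 'rV[R]_N) : Prop :=
  phi x = u x /\ \forall y \near x, u y <= phi y.

Definition touches_below (R : realType) (N : nat) (phi u : 'rV[R]_N -> R)
    (x : 'rV[R]_N) : Prop :=
  phi x = u x /\ \forall y \near x, phi y <= u y.

(* An operator F(x, r, p, X). *)
Definition operator (R : realType) (N : nat) : Type :=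
  'rV[R]_N -> R -> 'rV[R]_N -> 'M[R]_N -> R.

(* Functions on [Omega] (or on its closure) are total functions whose values
   elsewhere are irrelevant; as [Omega] is open, [\near x] only sees [Omega].
   Test functions need only be C^2 around the touching point. *)
Definition subsolution (R : realType) (N : nat) (F : operator R N)
    (Omega : set 'rV[R]_N) (u : 'rV[R]_N -> R) : Prop :=
  usc_on Omega u /\
  forall (x : 'rV[R]_N) (U : set 'rV[R]_N) (phi : 'rV[R]_N -> R),
    Omega x -> open U -> U x -> C2_on U phi -> touches_above phi u x ->
    0 <= F x (u x) (grad phi x) (hess phi x).

Definition supersolution (R : realType) (N : nat) (F : operator R N)
    (Omega : set 'rV[R]_N) (u : 'rV[R]_N -> R) : Prop :=
  lsc_on Omega u /\
  forall (x : 'rV[R]_N) (U : set 'rV[R]_N) (phi : 'rV[R]_N -> R),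
    Omega x -> open U -> U x -> C2_on U phi -> touches_below phi u x ->
    F x (u x) (grad phi x) (hess phi x) <= 0.

Definition boundary (R : realType) (N : nat) (A : set 'rV[R]_N) : set 'rV[R]_N :=
  closure A `\` interior A.

(* The filter x -> boundary of Omega, x in Omega, generated by the sets
   {x in Omega | dist(x, boundary) < e}. *)
Definition to_boundary (R : realType) (N : nat) (Omega : set 'rV[R]_N) :
    set_system 'rV[R]_N :=
  [set A | exists2 e : R, 0 < e & forall x y,
     Omega x -> boundary Omega y -> enorm (x - y) < e -> A x].

Definition maximum_principle (R : realType) (N : nat) (F : operator R N)
    (Omega : set 'rV[R]_N) : Prop :=
  forall u : 'rV[R]_N -> R, subsolution F Omega u ->
    (limf_esup (fun x => (u x)%:E) (to_boundary Omega) <= 0)%E ->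
    forall x, Omega x -> u x <= 0.

Definition minimum_principle (R : realType) (N : nat) (F : operator R N)
    (Omega : set 'rV[R]_N) : Prop :=
  forall u : 'rV[R]_N -> R, supersolution F Omega u ->
    (0 <= limf_einf (fun x => (u x)%:E) (to_boundary Omega))%E ->
    forall x, Omega x -> 0 <= u x.

Definition Emu (R : realType) (N k : nat) (H : 'rV[R]_N -> 'rV[R]_N -> R)
    (mu : R) : operator R N :=
  fun x r p X => Pminus k X + H x p + mu * r.

(* The suprema are extended reals: they may be infinite. *)
Definition mubar_plus (R : realType) (N k : nat)
    (H : 'rV[R]_N -> 'rV[R]_N -> R) (Omega : set 'rV[R]_N) : \bar R :=
  ereal_sup [set mu%:E | mu in [set mu : R | exists w : 'rV[R]_N -> R,
    [/\ forall x, closure Omega x -> 0 < w x,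
        lsc_on (closure Omega) w
      & supersolution (Emu k H mu) Omega w]]].

Definition mubar_minus (R : realType) (N k : nat)
    (H : 'rV[R]_N -> 'rV[R]_N -> R) (Omega : set 'rV[R]_N) : \bar R :=
  ereal_sup [set mu%:E | mu in [set mu : R | exists w : 'rV[R]_N -> R,
    [/\ forall x, closure Omega x -> w x < 0,
        usc_on (closure Omega) w
      & subsolution (Emu k H mu) Omega w]]].

Definition modulus_of_continuity (R : realType) (omega : R -> R) : Prop :=
  [/\ forall s, 0 <= s -> 0 <= omega s,
      forall s t, 0 <= s -> s <= t -> omega s <= omega t,
      omega 0 = 0
    & omega s @[s --> 0^'+] --> 0].

(* Main.v *)
Require Import Defs.
From HB Require Import structures.
From mathcomp Require Import all_boot all_order all_algebra.
From mathcomp Require Import all_classical all_reals all_analysis.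
From mathcomp Require Import perm.
From mathcomp Require Import ring lra.

Set Implicit Arguments.
Unset Strict Implicit.
Unset Printing Implicit Defensive.

Import Order.TTheory GRing.Theory Num.Theory.
Import numFieldNormedType.Exports.
Local Open Scope classical_set_scope.
Local Open Scope ring_scope.

(** Let [u] be a subsolution for [mu1] and [v] a supersolution for [mu2], with
[u <= v] on a compact set and contact only at interior points, where
[mu1 u < mu2 v].  Both parts of the theorem reduce to the impossibility of this,
one of the two functions being a multiple of the [w] in the definition of the
critical value: a multiple touching the other function.  Doubling of
variables leads to the sup-convolutions of [u] and [- v], that is, up to a quadratic
term, to convex Lipschitz functions [F] and [G] with [F + G - al |y|^2] maximal
at a point [y0], near which the gradients vary little.

The theorem on sums (Jensen's lemma and Alexandrov's theorem) is avoided as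
follows.  As the gradient is frozen near [y0], [F] satisfies there, in the
viscosity sense, the constant coefficient inequality
[sum_l <D^2 F a_l, a_l> >= c] for every orthonormal [k]-frame [a], because the
sum of the [k] smallest eigenvalues is the minimum of these traces.  Such a
linear inequality passes to mollifications of [F], which are therefore
classical solutions and serve as test functions for [v].  For the mollification
step, [F] is compared with its averages under a random walk of small step
along the [a_l], a discrete heat flow: the comparison principle gives
[F <= walk^n F - n sigma c + o(n sigma)], an inequality stable under averaging,
and Taylor expansion turns it back into a differential inequality. *)

(** * Averages over segments *)

(** The penalty is split at a third point: (al/4)|x - z|^2 is the minimum over y of (al/2)(|x - y|^2
    + |z - y|^2), attained at the midpoint. Thus the transforms F of u and G of - v satisfy F + G <=
    al |y|^2 + m, with equality at the midpoint y0 of a maximal pair. Two convex functions whose sum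
    is touched from above by a paraboloid at y0 are both differentiable there, and subgradients
    nearby differ from the one at y0 by O(|y - y0|). This freezes the argument of H, and also the
    zeroth order terms, although u and v are only semicontinuous. The order of choices is essential:
    the constant c bounding the traces for F does not depend on the frame, so the frame can be
    chosen last, as the one realizing the sum of the smallest eigenvalues for the Hessian tested on
    v. Mollification averages over axis-parallel segments, so that only one-dimensional integrals
    occur and derivatives are difference quotients. *)

Definition lip (R : realType) (N : nat) (L : R) (F : 'rV[R]_N -> R) : Prop :=
  forall x y, `|F x - F y| <= L * `|x - y|.

Lemma near_norm (R : realType) (V : normedModType R) (x : V) (e : R) : 0 < e ->
  \forall y \near x, `|y - x| < e.
Proof.
move=> e0; have := nbhsx_ballx x e e0.
by apply: filterS => y; rewrite -ball_normE /= distrC.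
Qed.

Lemma mvt_eq (R : realType) (f df : R -> R) (a b : R) : a <= b ->
  (forall t : R, a <= t <= b -> is_derive t 1 f (df t)) ->
  exists2 c, a <= c <= b & f b - f a = df c * (b - a).
Proof.
move=> ab dfE; have [c|t tab|c] := @MVT_segment _ f df a b ab.
- by move=> /[!in_itv]/= /andP[ac cb]; apply: dfE; rewrite !ltW.
- apply: derivable_within_continuous => c /[!in_itv]/= cab.
  by have [] := dfE _ cab.
by rewrite in_itv/=; exists c.
Qed.

Lemma lip_line_continuous (R : realType) (N : nat) (L : R) (F : 'rV[R]_N -> R)
    (x v : 'rV[R]_N) : 0 <= L -> lip L F -> continuous (fun t : R => F (x + t *: v)).
Proof.
move=> L0 FL t; apply/cvgrPdist_le => /= e e0.
pose C := L * `|v| + 1.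
have C0 : 0 < C by rewrite ltr_wpDl// mulr_ge0.
near=> s; apply: le_trans (FL _ _) _.
rewrite opprD addrACA subrr add0r -scalerBl normrZ.
have ts : `|t - s| <= e / C.
  by rewrite distrC ltW//; near: s; apply: (@near_norm _ R^o _ (e / C)); rewrite divr_gt0.
have -> : e = C * (e / C) by rewrite mulrCA divff ?mulr1// gt_eqF.
rewrite [leLHS](_ : _ = (L * `|v|) * `|t - s|); last by rewrite mulrCA mulrC.
apply: ler_pM => //; first exact: mulr_ge0.
by rewrite /C lerDl.
Unshelve. all: by end_near. Qed.

(** The range from -1 to 2 leaves room for shifting the unit interval by steps |h| <= 1, as the
    derivative of an average requires; integrating over the interval from -2 to 3 keeps all these
    points interior. *)
Lemma antiderivative (R : realType) (f : R -> R) : continuous f ->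
  exists P : R -> R, forall t : R, -1 <= t <= 2 -> is_derive t 1 P (f t).
Proof.
move=> fc; exists (fun x => \int[lebesgue_measure]_(t in [set` `[-2, x]]) f t)%R.
move=> t /andP[t1 t2].
have fi : lebesgue_measure.-integrable `[(-2 : R), (3 : R)] (EFin \o f).
  apply: continuous_compact_integrable; first exact: segment_compact.
  exact: continuous_subspaceT.
have t3 : t < 3 by lra.
have t2' : -2 < t by lra.
have [d1 d2] := continuous_FTC1_closed t3 fi t2' (fc t).
apply: DeriveDef; first exact: d1.
by rewrite -derive1E; exact: d2.
Qed.

Definition seg_avg (R : realType) (N : nat) (v : 'rV[R]_N) (F : 'rV[R]_N -> R)
    (x : 'rV[R]_N) : R :=
  \int[lebesgue_measure]_(t in [set` `[(0 : R), 1]]) F (x + t *: v).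

Section SegAvg.
Variables (R : realType) (N : nat).
Implicit Types (F G : 'rV[R]_N -> R) (x y v w : 'rV[R]_N) (L : R).

Definition is_lip F := exists2 L, 0 <= L & lip L F.

Lemma is_lip_line F x v : is_lip F -> continuous (fun t : R => F (x + t *: v)).
Proof. by case=> L L0 FL; exact: lip_line_continuous FL. Qed.

Arguments is_lip_line {F} x v.

Lemma seg_avgE v F x (P : R -> R) : is_lip F ->
  (forall t : R, 0 <= t <= 1 -> is_derive t 1 P (F (x + t *: v))) ->
  seg_avg v F x = P 1 - P 0.
Proof.
move=> FL dP.
have cP (t : R) : 0 <= t <= 1 -> {for t, continuous P}.
  move=> /dP[+ _] => /derivable1_diffP; exact: differentiable_continuous.
rewrite /seg_avg /Rintegral (@continuous_FTC2 R _ P)//=.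
- exact/continuous_subspaceT/is_lip_line.
- split.
  + by move=> t /[!in_itv]/= t01; have [] := dP t ltac:(lra).
  + by apply: cvg_at_right_filter; apply: cP; lra.
  + by apply: cvg_at_left_filter; apply: cP; lra.
- move=> t /[!in_itv]/= t01; have [_ <-] := dP t ltac:(lra).
  by rewrite derive1E.
Qed.

Lemma seg_antiderivative F x v : is_lip F ->
  exists P : R -> R, forall t : R, 0 <= t <= 1 -> is_derive t 1 P (F (x + t *: v)).
Proof.
move=> FL; have [P dP] := antiderivative (is_lip_line x v FL).
by exists P => t t01; apply: dP; lra.
Qed.

(** By the mean value theorem for the difference of the antiderivatives minus [c * t]. The two base
    points and the constant let this one lemma give monotonicity, Lipschitz bounds and stability of
    remainders. *)
Lemma seg_avg_le v F G x y (c : R) : is_lip F -> is_lip G ->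
  (forall t, 0 <= t <= 1 -> F (x + t *: v) <= G (y + t *: v) + c) ->
  seg_avg v F x <= seg_avg v G y + c.
Proof.
move=> FL GL FG.
have [P dP] := seg_antiderivative x v FL.
have [Q dQ] := seg_antiderivative y v GL.
rewrite (seg_avgE FL dP) (seg_avgE GL dQ).
pose h t := P t - Q t - c * t.
have dh (t : R) : 0 <= t <= 1 ->
    is_derive t 1 h (F (x + t *: v) - G (y + t *: v) - c).
  move=> t01.
  have ? := dP t ltac:(lra). have ? := dQ t ltac:(lra).
  rewrite /h; apply: is_derive_eq.
  by rewrite -[c%:A]/(c * 1) mulr1.
have [|s s01] := mvt_eq _ dh; first by [].
rewrite /h subr0 mulr0 mulr1 => E.
by have := FG s s01; move: E; lra.
Qed.

Lemma seg_avgD v F G x : is_lip F -> is_lip G ->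
  seg_avg v (fun z => F z + G z) x = seg_avg v F x + seg_avg v G x.
Proof.
move=> FL GL.
have [P dP] := seg_antiderivative x v FL.
have [Q dQ] := seg_antiderivative x v GL.
have dPQ (t : R) : 0 <= t <= 1 ->
    is_derive t 1 (fun s => P s + Q s) (F (x + t *: v) + G (x + t *: v)).
  by move=> t12; have ? := dP t t12; have ? := dQ t t12; apply: is_derive_eq.
rewrite (seg_avgE FL dP) (seg_avgE GL dQ) (seg_avgE (F := fun z => F z + G z) _ dPQ).
- by ring.
- case: FL GL => [L1 L10 FL] [L2 L20 GL].
  exists (L1 + L2); first exact: addr_ge0.
  move=> z z'; rewrite opprD addrACA mulrDl.
  by rewrite (le_trans (ler_normD _ _))// lerD.
Qed.

Lemma seg_avgZ v F x (c : R) : is_lip F ->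
  seg_avg v (fun z => c * F z) x = c * seg_avg v F x.
Proof.
move=> FL.
have [P dP] := seg_antiderivative x v FL.
have dcP (t : R) : 0 <= t <= 1 ->
    is_derive t 1 (fun s => c * P s) (c * F (x + t *: v)).
  by move=> t12; have ? := dP t t12; apply: is_derive_eq.
rewrite (seg_avgE FL dP) (seg_avgE (F := fun z => c * F z) _ dcP).
- by ring.
- case: FL => [L L0 FL]; exists (`|c| * L); first exact: mulr_ge0.
  by move=> z z'; rewrite -mulrBr normrM -mulrA ler_wpM2l.
Qed.

Lemma seg_avg_shift v F x y :
  seg_avg v (fun z => F (z + y)) x = seg_avg v F (x + y).
Proof. by apply: eq_Rintegral => t _; rewrite addrAC. Qed.

Lemma lip_seg_avg v F L : 0 <= L -> lip L F -> lip L (seg_avg v F).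
Proof.
move=> L0 FL.
have FL' : is_lip F by exists L.
have H x y : seg_avg v F x <= seg_avg v F y + L * `|x - y|.
  apply: seg_avg_le => // t _.
  have := FL (x + t *: v) (y + t *: v).
  rewrite opprD addrACA subrr addr0 => /(le_trans (ler_norm _)); lra.
move=> x y; rewrite ler_norml; have := H x y; have := H y x.
by rewrite (distrC y x); lra.
Qed.

Lemma seg_avg_dist v F L x : 0 <= L -> lip L F ->
  `|seg_avg v F x - F x| <= L * `|v|.
Proof.
move=> L0 FL.
have FL' : is_lip F by exists L.
have C : is_lip (fun _ : 'rV[R]_N => F x).
  by exists 0 => // ? ?; rewrite subrr normr0 mul0r.
have E : seg_avg v (fun _ => F x) x = F x.
  suff dx (t : R) : 0 <= t <= 1 -> is_derive t 1 (fun s => F x * s) (F x).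
    by rewrite (seg_avgE C dx) mulr0 mulr1 subr0.
  move=> _; apply: is_derive_eq.
  by rewrite -[(F x)%:A]/(F x * 1) mulr1.
have H (t : R) : 0 <= t <= 1 -> `|F (x + t *: v) - F x| <= L * `|v|.
  move=> t01; apply: le_trans (FL _ _) _; rewrite addrC addKr normrZ.
  apply: ler_wpM2l => //; rewrite ler_piMl// ger0_norm; lra.
have H1 : seg_avg v F x <= seg_avg v (fun _ => F x) x + L * `|v|.
  by apply: seg_avg_le => // t /H; rewrite ler_norml; lra.
have H2 : seg_avg v (fun _ => F x) x <= seg_avg v F x + L * `|v|.
  by apply: seg_avg_le => // t /H; rewrite ler_norml; lra.
move: H1 H2; rewrite E ler_norml; lra.
Qed.

(* Differentiability with a quadratic remainder uniform in [x]: a finite system of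
   inequalities, hence stable under averaging, without any interchange of
   derivative and integral. *)
Definition qder (C : R) G v (G' : 'rV[R]_N -> R) :=
  forall x h, `|G (x + h *: v) - G x - h * G' x| <= C * h ^+ 2.

(** Formally, differentiating the integral of F(x + t v) over 0 <= t <= 1 along v gives the
    increment of F over the segment. Each end point contributes an error L |v| h^2. *)
Lemma seg_avg_qder v F L : 0 <= L -> lip L F ->
  qder (2 * L * `|v|) (seg_avg v F) v (fun x => F (x + v) - F x).
Proof.
move=> L0 FL x h.
have FL' : is_lip F by exists L.
(* For |h| > 1 the Lipschitz bounds, linear in |h|, already lie below the quadratic remainder. *)
have [h1|h1] := leP `|h| 1; last first.
  have xvx (w : 'rV[R]_N) : x + w - x = w by rewrite addrAC subrr add0r.
  have := lip_seg_avg v L0 FL (x + h *: v) x; rewrite xvx normrZ => B1.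
  have := FL (x + v) x; rewrite xvx => B2.
  apply: le_trans (ler_normB _ _) _.
  have A0 : 0 <= L * `|v| by exact: mulr_ge0.
  rewrite normrM -(real_normK (num_real h)).
  have B3 : `|h| * `|F (x + v) - F x| <= `|h| * (L * `|v|) by rewrite ler_wpM2l.
  have A1 : 0 <= L * `|v| * (`|h| * (`|h| - 1)).
    by rewrite !mulr_ge0// subr_ge0 ltW.
  apply: le_trans (lerD B1 B3) _; nra.
have [P dP] := antiderivative (is_lip_line x v FL').
have dP' (t : R) : 0 <= t <= 1 -> is_derive t 1 P (F (x + t *: v)).
  by move=> t01; apply: dP; lra.
rewrite (seg_avgE FL' dP').
have h1' : -1 <= h <= 1 by rewrite -ler_norml.
have K (s : R) : -1 <= s + h <= 2 -> -1 <= s <= 2 ->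
    `|P (s + h) - P s - h * F (x + s *: v)| <= L * `|v| * h ^+ 2.
  move=> s1 s2.
  have [c c1 ->] : exists2 c, `|c - s| <= `|h| & P (s + h) - P s = F (x + c *: v) * h.
    have [h0|h0] := leP 0 h.
      have [|t ts|c cs ->] := @mvt_eq _ P (fun t => F (x + t *: v)) s (s + h).
      - lra.
      - apply: dP; lra.
      - exists c; last by rewrite addrAC subrr add0r.
        rewrite !ger0_norm//; lra.
    have [|t ts|c cs E] := @mvt_eq _ P (fun t => F (x + t *: v)) (s + h) s.
    - lra.
    - apply: dP; lra.
    - exists c; last by rewrite -opprB E; ring.
      rewrite !ler0_norm//; lra.
  rewrite (mulrC _ h) -mulrBr normrM.
  have := FL (x + c *: v) (x + s *: v).
  rewrite opprD addrACA subrr add0r -scalerBl normrZ => E.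
  rewrite -(real_normK (num_real h)) expr2.
  rewrite (mulrC (L * _)) -mulrA ler_wpM2l// (le_trans E)//.
  by rewrite mulrCA ler_wpM2r// mulr_ge0.
(* Moving the base point shifts the antiderivative, so the change of the average involves only the
   short intervals of length |h| at 0 and at 1. *)
have -> : seg_avg v F (x + h *: v) = P (1 + h) - P (0 + h).
  suff dPh (t : R) : 0 <= t <= 1 ->
      is_derive t 1 (fun s => P (s + h)) (F (x + h *: v + t *: v)).
    by rewrite (seg_avgE FL' dPh).
  move=> t01; have ? := dP (t + h) ltac:(lra).
  rewrite -addrA -scalerDl (addrC h).
  by apply: is_derive_eq; rewrite addr0 mulr1.
have := K 1 ltac:(lra) ltac:(lra); have := K 0 ltac:(lra) ltac:(lra).
rewrite scale1r scale0r addr0 !ler_norml; lra.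
Qed.
End SegAvg.

(** * Mollification by iterated segment averages *)

Section Mollify.
Variables (R : realType) (N : nat).
Implicit Types (F G : 'rV[R]_N -> R) (x y v w : 'rV[R]_N) (L : R).

Lemma is_lipD F G : is_lip F -> is_lip G -> is_lip (fun z => F z + G z).
Proof.
case=> [L1 L10 FL] [L2 L20 GL]; exists (L1 + L2); first exact: addr_ge0.
move=> z z'; rewrite opprD addrACA mulrDl.
by rewrite (le_trans (ler_normD _ _))// lerD.
Qed.

Lemma is_lipZ F (c : R) : is_lip F -> is_lip (fun z => c * F z).
Proof.
case=> L L0 FL; exists (`|c| * L); first exact: mulr_ge0.
by move=> z z'; rewrite -mulrBr normrM -mulrA ler_wpM2l.
Qed.

Lemma lip_shift F L y : lip L F -> lip L (fun z => F (z + y)).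
Proof. by move=> FL z z'; have := FL (z + y) (z' + y); rewrite opprD addrACA subrr addr0. Qed.

Lemma is_lip_shift F y : is_lip F -> is_lip (fun z => F (z + y)).
Proof. by case=> L L0 FL; exists L => //; exact: lip_shift. Qed.

Lemma lip_diff F L v : lip L F -> lip (2 * L) (fun z => F (z + v) - F z).
Proof.
move=> FL z z'; rewrite opprD addrACA -mulrA mulr_natl mulr2n.
rewrite (le_trans (ler_normD _ _))// lerD//; last by rewrite -opprD normrN.
exact: (lip_shift v FL).
Qed.

Definition moll (vs : seq 'rV[R]_N) F := foldr (@seg_avg R N) F vs.

Lemma lip_moll vs F L : 0 <= L -> lip L F -> lip L (moll vs F).
Proof. by move=> L0 FL; elim: vs => //= v vs; exact: lip_seg_avg. Qed.

Lemma is_lip_moll vs F : is_lip F -> is_lip (moll vs F).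
Proof. by case=> L L0 FL; exists L => //; exact: lip_moll. Qed.

Lemma mollD vs F G : is_lip F -> is_lip G ->
  moll vs (fun z => F z + G z) = (fun z => moll vs F z + moll vs G z).
Proof.
move=> FL GL; elim: vs => //= v vs ->; apply/funext => x.
by rewrite seg_avgD//; exact: is_lip_moll.
Qed.

Lemma mollZ vs F (c : R) : is_lip F ->
  moll vs (fun z => c * F z) = (fun z => c * moll vs F z).
Proof.
move=> FL; elim: vs => //= v vs ->; apply/funext => x.
by rewrite seg_avgZ//; exact: is_lip_moll.
Qed.

Lemma moll_shift vs F y : moll vs (fun z => F (z + y)) = (fun z => moll vs F (z + y)).
Proof. by elim: vs => //= v vs ->; apply/funext => x; rewrite seg_avg_shift. Qed.

Lemma moll_diff vs F v : is_lip F ->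
  moll vs (fun z => F (z + v) - F z) = (fun z => moll vs F (z + v) - moll vs F z).
Proof.
move=> FL.
have -> : (fun z => F (z + v) - F z) = (fun z => F (z + v) + (-1) * F z).
  by apply/funext => z; rewrite mulN1r.
rewrite mollD ?mollZ ?moll_shift//; first by apply/funext => z; rewrite mulN1r.
- exact: is_lip_shift.
- exact: is_lipZ.
Qed.

Lemma moll_sum vs (I : Type) (r : seq I) (F : I -> 'rV[R]_N -> R) :
  (forall i, is_lip (F i)) ->
  is_lip (fun z => \sum_(i <- r) F i z) /\
  moll vs (fun z => \sum_(i <- r) F i z) = (fun z => \sum_(i <- r) moll vs (F i) z).
Proof.
move=> FL; elim: r => [|i r [IHL IH]].
  have E : (fun z => \sum_(i <- [::]) F i z) = (fun _ : 'rV[R]_N => 0).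
    by apply/funext => z; rewrite big_nil.
  have E0 : (fun _ : 'rV[R]_N => 0) = (fun _ => 0 * (0 : R)) by apply/funext => z; rewrite mul0r.
  have C0 : is_lip (fun _ : 'rV[R]_N => 0).
    by exists 0 => // z z'; rewrite subrr normr0 mul0r.
  rewrite E; split=> //; rewrite {1}E0 mollZ//.
  by apply/funext => z; rewrite big_nil mul0r.
have E : (fun z => \sum_(j <- i :: r) F j z) = (fun z => F i z + \sum_(j <- r) F j z).
  by apply/funext => z; rewrite big_cons.
rewrite E; split; first exact: is_lipD.
by rewrite mollD// IH; apply/funext => z; rewrite big_cons.
Qed.

Lemma moll_dist vs F L x : 0 <= L -> lip L F ->
  `|moll vs F x - F x| <= L * \sum_(v <- vs) `|v|.
Proof.
move=> L0 FL; elim: vs => [|v vs IH] /=; first by rewrite subrr normr0 big_nil mulr0.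
have := seg_avg_dist v x L0 (lip_moll vs L0 FL).
move: IH; rewrite big_cons mulrDr !ler_norml; lra.
Qed.

(** An average only sees points within the total length of the segments; this locality carries an
    inequality known only in a ball over to the averages. *)
Lemma moll_le vs F G x (c : R) : is_lip F -> is_lip G ->
  (forall y, `|y - x| <= \sum_(v <- vs) `|v| -> F y <= G y + c) ->
  moll vs F x <= moll vs G x + c.
Proof.
move=> FL GL; elim: vs x => [|v vs IH] x /= FG.
  by apply: FG; rewrite subrr normr0 big_nil.
apply: seg_avg_le => [||t t01]; try exact: is_lip_moll.
apply: IH => y yx; apply: FG; rewrite big_cons.
have -> : y - x = t *: v + (y - (x + t *: v)) by rewrite opprD (addrA y) [RHS]addrC subrK.
apply: le_trans (ler_normD _ _) _; apply: lerD => //.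
by rewrite normrZ ler_piMl// ger0_norm; lra.
Qed.

Lemma seg_avg_qder_stable (C : R) w G v (G' : 'rV[R]_N -> R) :
  is_lip G -> is_lip G' -> qder C G v G' ->
  qder C (seg_avg w G) v (seg_avg w G').
Proof.
move=> GL GL' qG x h.
have L1 : is_lip (fun z => h * G' z) by exact: is_lipZ.
have L2 : is_lip (fun z => G z + h * G' z) by exact: is_lipD.
have E : seg_avg w (fun z => G z + h * G' z) x = seg_avg w G x + h * seg_avg w G' x.
  by rewrite seg_avgD// seg_avgZ.
have H t : `|G (x + h *: v + t *: w) - (G (x + t *: w) + h * G' (x + t *: w))| <= C * h ^+ 2.
  by rewrite (addrAC x) opprD addrA; exact: qG.
have H1 : seg_avg w G (x + h *: v) <= seg_avg w (fun z => G z + h * G' z) x + C * h ^+ 2.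
  by apply: seg_avg_le => // t _; have := H t; rewrite ler_norml; lra.
have H2 : seg_avg w (fun z => G z + h * G' z) x <= seg_avg w G (x + h *: v) + C * h ^+ 2.
  by apply: seg_avg_le => // t _; have := H t; rewrite ler_norml; lra.
move: H1 H2; rewrite E ler_norml; lra.
Qed.

(** One average along [v] is traded for an increment; the averages inside it preserve the Lipschitz
    constant, those outside it preserve the remainder. *)
Lemma moll_qder vs F v L : v \in vs -> 0 <= L -> lip L F ->
  qder (2 * L * `|v|) (moll vs F) v (moll (rem v vs) (fun z => F (z + v) - F z)).
Proof.
move=> + L0 FL; have FL' : is_lip F by exists L.
elim: vs => //= w vs IH; rewrite inE; case: (eqVneq w v) => [-> _|wv].
  rewrite moll_diff//; apply: seg_avg_qder => //; exact: lip_moll.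
move=> /= vvs; apply: seg_avg_qder_stable; last exact: IH.
  exact: is_lip_moll.
by apply: is_lip_moll; exists (2 * L); [exact: mulr_ge0|exact: lip_diff].
Qed.

End Mollify.

(** * Second-order jets and mollification *)

Section Norm.
Variables (R : realType) (N : nat).
Implicit Types (x y : 'rV[R]_N).

Lemma coord_le_norm x i : `|x 0 i| <= `|x|.
Proof.
rewrite [leRHS]mx_normrE.
exact: (le_bigmax _ (fun ij : 'I_1 * 'I_N => `|x ij.1 ij.2|) (0, i)).
Qed.

Lemma norm_le_coord x (c : R) : 0 <= c -> (forall i, `|x 0 i| <= c) -> `|x| <= c.
Proof.
move=> c0 xc; rewrite [leLHS]mx_normrE; apply: bigmax_le => // -[i j] _ /=.
by rewrite ord1.
Qed.

Lemma norm_delta_le (i : 'I_N) : `|delta_mx 0 i : 'rV[R]_N| <= 1.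
Proof.
apply: norm_le_coord => // j; rewrite mxE eqxx /=.
by case: eqP; rewrite ?normr1 ?normr0.
Qed.

Lemma lip_continuous L (F : 'rV[R]_N -> R) : 0 <= L -> lip L F -> continuous F.
Proof.
move=> L0 FL x; apply/(@cvgrPdist_le _ _ _ _ (nbhs_filter x)) => e e0.
have C0 : 0 < L + 1 by lra.
have key : \forall y \near x, `|y - x| < e / (L + 1).
  by apply: near_norm; rewrite divr_gt0.
apply: filterS key => y xy; apply: le_trans (FL _ _) _; rewrite distrC.
have : (L + 1) * `|y - x| <= e by rewrite -ler_pdivlMl// mulrC ltW.
have : 0 <= `|y - x| by [].
lra.
Qed.

Lemma quad_is_derive (V : normedModType R) (f : V -> R) (x v : V) (d C : R) :
  (forall h, `|f (x + h *: v) - f x - h * d| <= C * h ^+ 2) -> is_derive x v f d.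
Proof.
move=> fd.
have C0 : 0 <= C.
  by have := fd 1; rewrite expr1n mulr1; apply: le_trans.
suff fl : h^-1 *: ((f \o shift x) (h *: v) - f x) @[h --> 0^'] --> d.
  apply: DeriveDef; first by apply/cvg_ex; exists d.
  exact/cvg_lim.
apply/cvgrPdist_le => e e0.
near=> h.
have h0 : h != 0 by near: h; exact: nbhs_dnbhs_neq.
have hC : `|h| <= e / (C + 1).
  near: h; apply: dnbhs0_le; rewrite divr_gt0//; lra.
suff G : `|d - h^-1 * (f (x + h *: v) - f x)| <= e.
  by rewrite /= (addrC _ x); exact: G.
have -> : d - h^-1 * (f (x + h *: v) - f x) =
    - (h^-1 * (f (x + h *: v) - f x - h * d)) by field.
rewrite normrN normrM normfV ler_pdivrMl ?normr_gt0//.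
apply: le_trans (fd h) _; rewrite -(real_normK (num_real h)).
have : (C + 1) * `|h| <= e by rewrite -ler_pdivlMl ?(mulrC _ e)//; lra.
have : 0 <= `|h| by [].
nra.
Unshelve. all: by end_near. Qed.

End Norm.

Section Jet.
Variables (R : realType) (N : nat).
Implicit Types (x y : 'rV[R]_N) (f phi : 'rV[R]_N -> R) (g : 'rV[R]_N -> 'rV[R]_N)
  (X : 'rV[R]_N -> 'M[R]_N) (K : R).

Notation e_ i := (delta_mx 0 i : 'rV[R]_N).

Definition qgrad K f (g : 'rV[R]_N -> 'rV[R]_N) :=
  forall i, qder K f (e_ i) (fun x => g x 0 i) /\ lip K (fun x => g x 0 i).

(** Moving one coordinate at a time, each of the [N] moves costs K |y|^2 by its remainder and at
    most N K |y|^2 for bringing the partial derivative back to the base point [x]. *)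
Lemma qgrad_taylor K f g x y : 0 <= K -> qgrad K f g ->
  `|f (x + y) - f x - \sum_i y 0 i * g x 0 i| <= N%:R * (K * (1 + N%:R)) * `|y| ^+ 2.
Proof.
move=> K0 fg.
suff H (r : seq 'I_N) : (size r <= N)%N ->
    `|\sum_(i <- r) y 0 i *: e_ i| <= (size r)%:R * `|y| /\
    `|f (x + \sum_(i <- r) y 0 i *: e_ i) - f x - \sum_(i <- r) y 0 i * g x 0 i|
      <= (size r)%:R * (K * (1 + N%:R)) * `|y| ^+ 2.
  have := (H (enum 'I_N) _).2; rewrite size_enum_ord !big_enum -row_sum_delta /=.
  exact.
elim: r => [_|i r IH /= rN]; first by rewrite !big_nil addr0 !subrr !normr0 !mul0r.
have {IH}[IH1 IH2] := IH (ltnW rN).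
rewrite !big_cons; set s := \sum_(i <- r) _ in IH1 IH2 *.
set S := \sum_(i <- r) _ in IH2 *.
have yi := coord_le_norm y i.
split.
  apply: le_trans (ler_normD _ _) _.
  rewrite -natr1 mulrDl mul1r addrC lerD// normrZ.
  by rewrite -[leRHS]mulr1 ler_pM// norm_delta_le.
have [qi li] := fg i.
have q := qi (x + s) (y 0 i).
have l := li (x + s) x.
have sN : `|s| <= N%:R * `|y|.
  by apply: le_trans IH1 _; rewrite ler_wpM2r// ler_nat ltnW.
rewrite (_ : x + s - x = s) in l; last by rewrite addrAC subrr add0r.
have -> : x + (y 0 i *: e_ i + s) = x + s + y 0 i *: e_ i by rewrite [_ + s]addrC addrA.
have -> : f (x + s + y 0 i *: e_ i) - f x - (y 0 i * g x 0 i + S) =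
  (f (x + s) - f x - S) + ((f (x + s + y 0 i *: e_ i) - f (x + s) - y 0 i * g (x + s) 0 i)
  + y 0 i * (g (x + s) 0 i - g x 0 i)) by ring.
apply: le_trans (ler_normD _ _) _.
rewrite -natr1 !mulrDl mul1r; apply: lerD => //.
apply: le_trans (ler_normD _ _) _.
rewrite [leRHS](_ : _ = K * `|y| ^+ 2 + `|y| * (K * (N%:R * `|y|))); last by ring.
apply: lerD.
  apply: le_trans q _; apply: ler_wpM2l => //.
  by rewrite -(real_normK (num_real (y 0 i))) lerXn2r ?nnegrE.
rewrite normrM; apply: ler_pM => //.
by apply: le_trans l _; exact: ler_wpM2l.
Qed.

Definition qform (X : 'M[R]_N) (y : 'rV[R]_N) : R :=
  \sum_i y 0 i * \sum_j y 0 j * X i j.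

(** A quantitative C^{2,1} function with gradient and Hessian as data. The class is closed under the
    sums, multiples, shifts and walks applied to test functions, so that derivatives are tracked by
    algebra. *)
Record jet K phi g X : Prop := Jet {
  jet_K : 0 <= K;
  jet_cont : continuous phi;
  jet_grad : qgrad K phi g;
  jet_hess : forall i, qgrad K (fun x => g x 0 i) (fun x => row i (X x));
  jet_sym : forall x, (X x)^T = X x }.

Definition jet_const K := 4 * N%:R * (N%:R * (K * (1 + N%:R))).

(** The mean value theorem in the scale [t] turns the second difference into a difference of
    gradients at x + c y and x - c y. After expansion at x the linear parts cancel the derivative of
    t^2 times the quadratic form, whatever the intermediate c. *)
Lemma jet_second_diff K phi g X x y : jet K phi g X ->
  `|phi (x + y) + phi (x - y) - 2 * phi x - qform (X x) y| <=
  jet_const K * `|y| ^+ 3.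
Proof.
move=> [K0 _ gr he _].
pose C := N%:R * (K * (1 + N%:R)).
have C0 : 0 <= C by rewrite !mulr_ge0// addr_ge0.
pose dphi z := \sum_i y 0 i * g z 0 i.
have dphiZ (c : R) z : \sum_i (c *: y) 0 i * g z 0 i = c * dphi z.
  by rewrite /dphi mulr_sumr; apply: eq_bigr => i _; rewrite mxE mulrA.
have d1 (t : R) : is_derive t 1 (fun s => phi (x + s *: y)) (dphi (x + t *: y)).
  apply: (@quad_is_derive R R^o _ _ _ _ (C * `|y| ^+ 2)) => h.
  have := qgrad_taylor (x + t *: y) (h *: y) K0 gr.
  rewrite [h%:A]mulr1 scalerDl addrA normrZ exprMn real_normK ?num_real//.
  by rewrite -/C (mulrC (h ^+ 2)) (mulrA C) dphiZ.
have d2 (t : R) : is_derive t 1 (fun s => phi (x - s *: y)) (- dphi (x - t *: y)).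
  apply: (@quad_is_derive R R^o _ _ _ _ (C * `|y| ^+ 2)) => h.
  have := qgrad_taylor (x - t *: y) (- h *: y) K0 gr.
  rewrite [h%:A]mulr1 scalerDl opprD addrA.
  by rewrite -/C dphiZ scaleNr normrN normrZ exprMn real_normK ?num_real//
    (mulrC (h ^+ 2)) (mulrA C) mulrN mulNr.
pose k t := phi (x + t *: y) + phi (x - t *: y) - t ^+ 2 * qform (X x) y.
have dk (t : R) : 0 <= t <= 1 -> is_derive t 1 k
    (dphi (x + t *: y) - dphi (x - t *: y) - 2 * t * qform (X x) y).
  move=> _; rewrite /k; apply: is_derive_eq.
  by rewrite /GRing.scale /=; ring.
have [//|c c01] := mvt_eq _ dk.
rewrite /k !scale1r !scale0r subr0 addr0 expr1n mul1r expr0n /= mul0r !subr0 mulr1.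
move=> E.
have -> : phi (x + y) + phi (x - y) - 2 * phi x - qform (X x) y =
    phi (x + y) + phi (x - y) - qform (X x) y - (phi x + phi x) by ring.
rewrite E /dphi /qform mulr_sumr -!sumrB.
apply: le_trans (ler_norm_sum _ _ _) _.
have -> : jet_const K * `|y| ^+ 3 = \sum_(i < N) (4 * C * `|y| ^+ 3).
  by rewrite sumr_const card_ord /jet_const -/C -mulr_natl; ring.
apply: ler_sum => i _.
have T1 := qgrad_taylor x (c *: y) K0 (he i).
have T2 := qgrad_taylor x (- c *: y) K0 (he i).
rewrite -/C in T1 T2.
have c1 : c ^+ 2 <= 1 by move/andP: c01 => [? ?]; rewrite exprn_ile1.
have nc (s : R) : s ^+ 2 = c ^+ 2 -> C * `|s *: y| ^+ 2 <= C * `|y| ^+ 2.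
  move=> sc; apply: ler_wpM2l => //; rewrite normrZ exprMn real_normK ?num_real//.
  by rewrite sc ler_piMl// sqr_ge0.
have {}T1 := le_trans T1 (nc _ erefl).
have {}T2 := le_trans T2 (nc _ (sqrrN _)).
set q := \sum_j y 0 j * X x i j.
have E1 : \sum_j (c *: y) 0 j * row i (X x) 0 j = c * q.
  by rewrite /q mulr_sumr; apply: eq_bigr => j _; rewrite !mxE mulrA.
have E2 : \sum_j (- c *: y) 0 j * row i (X x) 0 j = - c * q.
  by rewrite /q mulr_sumr; apply: eq_bigr => j _; rewrite !mxE mulrA.
rewrite {}E1 in T1; rewrite {}E2 scaleNr in T2.
have -> : y 0 i * g (x + c *: y) 0 i - y 0 i * g (x - c *: y) 0 i - 2 * c * (y 0 i * q)
  = y 0 i * ((g (x + c *: y) 0 i - g x 0 i - c * q) -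
             (g (x - c *: y) 0 i - g x 0 i - (- c * q))) by ring.
rewrite normrM [leRHS](_ : _ = `|y| * (C * `|y| ^+ 2 + C * `|y| ^+ 2) * 2); last by ring.
have H := le_trans (ler_normB _ _) (lerD T1 T2).
apply: (@le_trans _ _ (`|y| * (C * `|y| ^+ 2 + C * `|y| ^+ 2))).
  by apply: ler_pM => //; exact: coord_le_norm.
rewrite ler_peMr//; last by lra.
by rewrite mulr_ge0// addr_ge0// mulr_ge0.
Qed.

End Jet.

Section JetAlgebra.
Variables (R : realType) (N : nat).
Implicit Types (x y : 'rV[R]_N) (f phi : 'rV[R]_N -> R) (g : 'rV[R]_N -> 'rV[R]_N)
  (X : 'rV[R]_N -> 'M[R]_N) (K : R).

Notation e_ i := (delta_mx 0 i : 'rV[R]_N).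

Definition dot x y : R := \sum_i x 0 i * y 0 i.
Definition sqn x : R := dot x x.

Lemma qgradD K1 K2 f1 f2 g1 g2 : qgrad K1 f1 g1 -> qgrad K2 f2 g2 ->
  qgrad (K1 + K2) (fun x => f1 x + f2 x) (fun x => g1 x + g2 x).
Proof.
move=> fg1 fg2 i; have [q1 l1] := fg1 i; have [q2 l2] := fg2 i; split.
  move=> x h; rewrite mxE mulrDl.
  have := q1 x h; have := q2 x h; rewrite !ler_norml; lra.
move=> x y; rewrite !mxE mulrDl.
have := l1 x y; have := l2 x y; rewrite !ler_norml; lra.
Qed.

Lemma qgradZ K f g c : qgrad K f g ->
  qgrad (`|c| * K) (fun x => c * f x) (fun x => c *: g x).
Proof.
move=> fg i; have [q l] := fg i; split.
  move=> x h; rewrite mxE mulrCA -!mulrBr normrM -mulrA.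
  by apply: ler_wpM2l => //; exact: q.
by move=> x y; rewrite !mxE -mulrBr normrM -mulrA ler_wpM2l.
Qed.

Lemma qgrad_shift K f g (e : 'rV[R]_N) : qgrad K f g ->
  qgrad K (fun x => f (x + e)) (fun x => g (x + e)).
Proof.
move=> fg i; have [q l] := fg i; split; last exact: (lip_shift e l).
by move=> x h; rewrite (addrAC x); exact: q.
Qed.

Lemma jetD K1 K2 phi1 phi2 g1 g2 X1 X2 : jet K1 phi1 g1 X1 -> jet K2 phi2 g2 X2 ->
  jet (K1 + K2) (fun x => phi1 x + phi2 x) (fun x => g1 x + g2 x)
    (fun x => X1 x + X2 x).
Proof.
move=> [K10 c1 gr1 he1 s1] [K20 c2 gr2 he2 s2]; split.
- exact: addr_ge0.
- by move=> x; apply: (@continuousD R R^o _ phi1 phi2); [exact: c1|exact: c2].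
- exact: qgradD.
- move=> i.
  rewrite (_ : (fun x => (g1 x + g2 x) 0 i) = (fun x => g1 x 0 i + g2 x 0 i)).
    rewrite (_ : (fun x => row i _) = (fun x => row i (X1 x) + row i (X2 x))).
      exact: qgradD.
    by apply/funext => x; rewrite linearD.
  by apply/funext => x; rewrite mxE.
- by move=> x; rewrite linearD /= s1 s2.
Qed.

Lemma jetZ K phi g X c : jet K phi g X ->
  jet (`|c| * K) (fun x => c * phi x) (fun x => c *: g x) (fun x => c *: X x).
Proof.
move=> [K0 co gr he s]; split.
- exact: mulr_ge0.
- by move=> x; apply: continuousM; [exact: cst_continuous|exact: co].
- exact: qgradZ.
- move=> i.
  rewrite (_ : (fun x => (c *: g x) 0 i) = (fun x => c * g x 0 i)).
    rewrite (_ : (fun x => row i _) = (fun x => c *: row i (X x))).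
      exact: qgradZ.
    by apply/funext => x; rewrite linearZ.
  by apply/funext => x; rewrite mxE.
- by move=> x; rewrite linearZ /= s.
Qed.

Lemma jet_shift K phi g X (e : 'rV[R]_N) : jet K phi g X ->
  jet K (fun x => phi (x + e)) (fun x => g (x + e)) (fun x => X (x + e)).
Proof.
move=> [K0 co gr he s]; split => //.
- move=> x; apply: (@continuous_comp _ _ _ (fun y => y + e) phi); last exact: co.
  by apply: continuousD; [exact: id|exact: cst_continuous].
- exact: qgrad_shift.
- by move=> i; exact: (qgrad_shift e (he i)).
Qed.

Lemma sum_coord_delta (F : 'I_N -> R) i : \sum_j F j * (e_ i) 0 j = F i.
Proof.
rewrite (bigD1 i)//= big1 ?addr0; first by rewrite mxE !eqxx mulr1.
by move=> j ji; rewrite mxE eqxx /= (negbTE ji) mulr0.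
Qed.

Lemma dotC x y : dot x y = dot y x.
Proof. by apply: eq_bigr => i _; rewrite mulrC. Qed.

Lemma dotDr x y z : dot x (y + z) = dot x y + dot x z.
Proof. by rewrite -big_split; apply: eq_bigr => i _; rewrite mxE mulrDr. Qed.

Lemma dotZr c x y : dot x (c *: y) = c * dot x y.
Proof. by rewrite /dot mulr_sumr; apply: eq_bigr => i _; rewrite mxE mulrCA. Qed.

Lemma dot0l x : dot 0 x = 0.
Proof. by rewrite /dot big1// => i _; rewrite mxE mul0r. Qed.

Lemma sqn0 : sqn 0 = 0.
Proof. exact: dot0l. Qed.

Lemma dotDl x y z : dot (x + y) z = dot x z + dot y z.
Proof. by rewrite dotC dotDr !(dotC z). Qed.

Lemma dotZl c x y : dot (c *: x) y = c * dot x y.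
Proof. by rewrite dotC dotZr dotC. Qed.

Lemma dotNr x y : dot x (- y) = - dot x y.
Proof. by rewrite -scaleN1r dotZr mulN1r. Qed.

Lemma dotNl x y : dot (- x) y = - dot x y.
Proof. by rewrite dotC dotNr dotC. Qed.

Lemma dot_delta x i : dot x (e_ i) = x 0 i.
Proof. exact: sum_coord_delta. Qed.

Lemma sqn_delta i : sqn (e_ i) = 1.
Proof. by rewrite /sqn dot_delta mxE !eqxx. Qed.

Lemma sqn_ge0 x : 0 <= sqn x.
Proof. by apply: sumr_ge0 => i _; rewrite -expr2 sqr_ge0. Qed.

Lemma norm_sqn x : `|x| ^+ 2 <= sqn x.
Proof.
suff : `|x| <= Num.sqrt (sqn x).
  move=> h; rewrite -(sqr_sqrtr (sqn_ge0 x)).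
  by rewrite lerXn2r ?nnegrE ?sqrtr_ge0.
apply: norm_le_coord => [|i]; first exact: sqrtr_ge0.
rewrite -sqrtr_sqr ler_wsqrtr// /sqn /dot (bigD1 i)//= expr2 lerDl.
by apply: sumr_ge0 => j _; rewrite -expr2 sqr_ge0.
Qed.

Lemma dot_le x y : `|dot x y| <= N%:R * `|x| * `|y|.
Proof.
apply: le_trans (ler_norm_sum _ _ _) _.
have -> : N%:R * `|x| * `|y| = \sum_(i < N) (`|x| * `|y|).
  by rewrite sumr_const card_ord -[RHS]mulr_natl mulrA.
by apply: ler_sum => i _; rewrite normrM ler_pM// coord_le_norm.
Qed.

Lemma dot_continuous x : continuous (dot x).
Proof.
apply: (@lip_continuous _ _ (N%:R * `|x|)); first exact: mulr_ge0.
by move=> y z; rewrite -dotNr -dotDr; exact: dot_le.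
Qed.

Lemma jet_affine b c : jet 0 (fun x => dot b x + c) (fun=> b) (fun=> 0).
Proof.
have q0 (d : R) : qgrad 0 (fun _ : 'rV[R]_N => d) (fun=> 0).
  by move=> i; split => [x h|x y]; rewrite ?mxE ?mulr0 subrr ?subr0 ?normr0 ?mul0r.
split => //.
- move=> x; apply: (@continuousD R R^o _ (dot b) (fun=> c)).
    exact: dot_continuous.
  exact: cst_continuous.
- move=> i; split => [x h|x y]; last by rewrite subrr normr0 mul0r.
  rewrite dotDr dotZr dot_delta mul0r normr_le0; apply/eqP; ring.
- by move=> i; rewrite row0; exact: q0.
- by move=> x; rewrite trmx0.
Qed.

Lemma sqn_continuous : continuous sqn.
Proof.
apply: (@continuous_big R^o _ (+%R) 0 predT) => // [|i _ x].
  exact: add_continuous.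
by apply: continuousM; exact: coord_continuous.
Qed.

Lemma sqnD x y : sqn (x + y) = sqn x + 2 * dot x y + sqn y.
Proof. by rewrite /sqn dotDl !dotDr (dotC y x); ring. Qed.

Lemma sqnZ c x : sqn (c *: x) = c ^+ 2 * sqn x.
Proof. by rewrite /sqn dotZl dotZr mulrA expr2. Qed.

Lemma sqnN x : sqn (- x) = sqn x.
Proof. by rewrite -scaleN1r sqnZ sqrrN expr1n mul1r. Qed.

Lemma jet_sqn : jet 2 sqn (fun x => 2 *: x) (fun=> 2%:M).
Proof.
split => //.
- exact: sqn_continuous.
- move=> i; split => [x h|x y].
    rewrite sqnD dotZr dot_delta sqnZ sqn_delta mxE.
    have -> : sqn x + 2 * (h * x 0 i) + h ^+ 2 * 1 - sqn x - h * (2 * x 0 i) = h ^+ 2 by ring.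
    by rewrite ger0_norm ?sqr_ge0// ler_peMl ?sqr_ge0//; lra.
  rewrite !mxE -mulrBr normrM ger0_norm//; apply: ler_wpM2l => //.
  by have := coord_le_norm (x - y) i; rewrite !mxE.
- move=> i j; split => [x h|x y]; last by rewrite subrr normr0 mulr_ge0.
  rewrite !mxE eqxx /=.
  have -> : 2 * (x 0 i + h * (i == j)%:R) - 2 * x 0 i - h * (2 *+ (i == j)) = 0.
    by rewrite -[_ *+ (i == j)]mulr_natr; ring.
  by rewrite normr0 mulr_ge0// sqr_ge0.
- by move=> x; rewrite tr_scalar_mx.
Qed.

Lemma qformD (X1 X2 : 'M[R]_N) y : qform (X1 + X2) y = qform X1 y + qform X2 y.
Proof.
rewrite /qform -big_split; apply: eq_bigr => i _ /=; rewrite -mulrDr -big_split.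
by congr (_ * _); apply: eq_bigr => j _; rewrite mxE mulrDr.
Qed.

Lemma qformZ c (X1 : 'M[R]_N) y : qform (c *: X1) y = c * qform X1 y.
Proof.
rewrite /qform mulr_sumr; apply: eq_bigr => i _ /=; rewrite [RHS]mulrCA.
by congr (_ * _); rewrite mulr_sumr; apply: eq_bigr => j _; rewrite mxE mulrCA.
Qed.

Lemma qform_scalar c y : qform (c%:M : 'M[R]_N) y = c * sqn y.
Proof.
rewrite /qform /sqn /dot mulr_sumr; apply: eq_bigr => i _ /=.
rewrite (bigD1 i)//= big1 ?addr0 => [|j ji]; first by rewrite mxE eqxx mulr1n; ring.
by rewrite mxE eq_sym (negbTE ji) mulr0n mulr0.
Qed.

Lemma jet_C1 K f g : continuous f -> 0 <= K -> qgrad K f g ->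
  C1_on setT f /\ grad f = g.
Proof.
move=> fc K0 fg.
have d x i : is_derive x (e_ i) f (g x 0 i).
  by apply: (@quad_is_derive R _ _ _ _ _ K) => h; exact: (fg i).1.
have p i : partial i f = (fun x => g x 0 i).
  by apply/funext => x; rewrite /partial derive_val.
split; last first.
  by apply/funext => x; apply/rowP => i; rewrite mxE p.
split => [x _|i x _]; first exact: fc.
split; first by have [] := d x i.
by rewrite p; apply: lip_continuous K0 _ _; exact: (fg i).2.
Qed.

Lemma jet_C2 K phi g X : jet K phi g X ->
  [/\ C2_on setT phi, grad phi = g & hess phi = X].
Proof.
move=> [K0 c gr he s].
have [c1 gE] := jet_C1 c K0 gr.
have p i : partial i phi = (fun x => g x 0 i).
  by apply/funext => x; rewrite -gE mxE.
have ci i : continuous (fun x => g x 0 i) by apply: lip_continuous K0 _; exact: (gr i).2.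
split => //.
  by split => // i; rewrite p; have [] := jet_C1 (ci i) K0 (he i).
apply/funext => x; apply/matrixP => i j; rewrite mxE p.
have [_ /(congr1 (fun h : 'rV[R]_N -> 'rV[R]_N => h x 0 j))] := jet_C1 (ci i) K0 (he i).
by rewrite !mxE.
Qed.

End JetAlgebra.

(** * Mollifications of Lipschitz functions are jets *)

Section MollJet.
Variables (R : realType) (N : nat).
Implicit Types (x y v : 'rV[R]_N) (F : 'rV[R]_N -> R) (L : R).

Notation e_ i := (delta_mx 0 i : 'rV[R]_N).

(* Each axis occurs twice, so that averaging along all of them gains two derivatives
   in every direction. *)
Definition axes (d : R) : seq 'rV[R]_N :=
  let s := [seq d *: e_ i | i <- enum 'I_N] in s ++ s.

Lemma mem_axes d i : d *: e_ i \in axes d.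
Proof. by rewrite mem_cat (map_f (fun i => d *: e_ i)) ?mem_enum. Qed.

Lemma mem_rem_axes d i j : d *: e_ j \in rem (d *: e_ i) (axes d).
Proof.
rewrite -has_pred1 has_count count_mem_rem subn_gt0.
apply: (@leq_ltn_trans 1); first exact: leq_b1.
rewrite count_cat.
have : (0 < count_mem (d *: e_ j) [seq d *: e_ i | i <- enum 'I_N])%N.
  by rewrite -has_count has_pred1 (map_f (fun i => d *: e_ i)) ?mem_enum.
by move=> c; exact: (leq_add c c).
Qed.

Lemma norm_axis d i : 0 <= d -> `|d *: e_ i| <= d.
Proof.
by move=> d0; rewrite normrZ ger0_norm// ler_piMr// norm_delta_le.
Qed.

Lemma axes_norm d : 0 <= d -> \sum_(v <- axes d) `|v| <= 2 * N%:R * d.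
Proof.
move=> d0; rewrite big_cat /= big_map big_enum /=.
have H : \sum_(i < N) `|d *: e_ i| <= N%:R * d.
  have -> : N%:R * d = \sum_(i < N) d by rewrite sumr_const card_ord -[RHS]mulr_natl.
  by apply: ler_sum => i _; exact: norm_axis.
lra.
Qed.

Lemma qder_scale (C d : R) F v (G' : 'rV[R]_N -> R) : 0 < d ->
  qder C F (d *: v) G' -> qder (d^-1 ^+ 2 * C) F v (fun x => d^-1 * G' x).
Proof.
move=> d0 q x h; have := q x (h / d).
rewrite scalerA divfK ?gt_eqF// exprMn.
have -> : C * (h ^+ 2 * d^-1 ^+ 2) = d^-1 ^+ 2 * C * h ^+ 2 by ring.
by have -> : h * (d^-1 * G' x) = h / d * G' x by ring.
Qed.

Lemma rem_rem (T : eqType) (a b : T) (s : seq T) : rem a (rem b s) = rem b (rem a s).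
Proof.
elim: s => //= c s IH.
have [cb|cb] := eqVneq c b; have [ca|ca] := eqVneq c a => /=.
- by rewrite -cb -ca.
- by rewrite cb eqxx.
- by rewrite ca eqxx.
- by rewrite (negbTE cb) (negbTE ca) IH.
Qed.

(** Each derivative spends one average and is a difference quotient of step [d]; increments double
    the Lipschitz constant, whence the orders L / d and L / d^2 in [K]. Symmetry of the Hessian is
    the commutation of two increments. *)
Lemma jet_moll (d L : R) F : 0 < d -> 0 <= L -> lip L F ->
  exists K g X, jet K (moll (axes d) F) g X.
Proof.
move=> d0 L0 FL.
pose v i := d *: e_ i.
pose D i G : 'rV[R]_N -> R := fun z => G (z + v i) - G z.
have LD i G M : lip M G -> lip (2 * M) (D i G) by exact: lip_diff.
have L20 : 0 <= 2 * L by exact: mulr_ge0.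
have L40 : 0 <= 2 * (2 * L) by exact: mulr_ge0.
have nv i : `|v i| <= d by exact: norm_axis (ltW d0).
pose g x := \row_i (d^-1 * moll (rem (v i) (axes d)) (D i F) x).
pose X x := \matrix_(i, j)
  (d^-1 * (d^-1 * moll (rem (v j) (rem (v i) (axes d))) (D j (D i F)) x)).
pose K := 4 * L * (d^-1 + d^-1 ^+ 2).
have di0 : 0 < d^-1 by rewrite invr_gt0.
have K0 : 0 <= K by rewrite !mulr_ge0// addr_ge0// ?sqr_ge0// ltW.
have K1 : 2 * (2 * L) * d^-1 <= K.
  rewrite /K; have : 0 <= L * d^-1 ^+ 2 by rewrite mulr_ge0// sqr_ge0.
  lra.
have K1' : 2 * L * d^-1 <= K.
  have : 0 <= L * d^-1 by rewrite mulr_ge0// ltW.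
  lra.
have K2 : 2 * (2 * L) * d^-1 ^+ 2 <= K.
  rewrite /K; have : 0 <= L * d^-1 by rewrite mulr_ge0// ltW.
  lra.
have q M i : 0 <= M -> M * d^-1 <= K -> d^-1 ^+ 2 * (M * `|v i|) <= K.
  move=> M0 MK; apply: le_trans MK.
  have -> : M * d^-1 = d^-1 ^+ 2 * (M * d) by field; rewrite gt_eqF.
  by rewrite ler_wpM2l ?sqr_ge0// ler_wpM2l.
exists K, g, X; split => //.
- exact: lip_continuous L0 (lip_moll _ L0 FL).
- move=> i; split.
    have /(qder_scale d0) h := moll_qder (mem_axes d i) L0 FL.
    move=> x t; rewrite mxE; apply: le_trans (h x t) _.
    by apply: ler_wpM2r; rewrite ?sqr_ge0// q.
  move=> x y; rewrite !mxE -mulrBr normrM gtr0_norm//.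
  apply: le_trans (ler_wpM2l (ltW di0) (lip_moll _ L20 (LD i _ _ FL) x y)) _.
  by rewrite mulrA; apply: ler_wpM2r; rewrite // mulrC.
- move=> i j; split.
    have /(qder_scale d0) h := moll_qder (mem_rem_axes d i j) L20 (LD i _ _ FL).
    move=> x t; rewrite !mxE.
    have -> : d^-1 * moll (rem (v i) (axes d)) (D i F) (x + t *: delta_mx 0 j) -
      d^-1 * moll (rem (v i) (axes d)) (D i F) x -
      t * (d^-1 * (d^-1 * moll (rem (v j) (rem (v i) (axes d))) (D j (D i F)) x)) =
      d^-1 * (moll (rem (v i) (axes d)) (D i F) (x + t *: delta_mx 0 j) -
      moll (rem (v i) (axes d)) (D i F) x -
      t * (d^-1 * moll (rem (v j) (rem (v i) (axes d))) (D j (D i F)) x)) by ring.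
    rewrite normrM gtr0_norm//.
    apply: le_trans (ler_wpM2l (ltW di0) (h x t)) _.
    rewrite [leLHS]mulrA; apply: ler_wpM2r; first exact: sqr_ge0.
    apply: le_trans K2.
    have -> : 2 * (2 * L) * d^-1 ^+ 2 = d^-1 * (d^-1 ^+ 2 * (2 * (2 * L) * d)).
      by field; rewrite gt_eqF.
    apply: ler_wpM2l; first exact: ltW.
    apply: ler_wpM2l; first exact: sqr_ge0.
    apply: ler_wpM2l => //; exact: nv.
  move=> x y; rewrite !mxE -mulrBr -mulrBr mulrA -expr2 normrM ger0_norm ?sqr_ge0//.
  have d20 : 0 <= d^-1 ^+ 2 := sqr_ge0 _.
  apply: le_trans (ler_wpM2l d20 (lip_moll _ L40 (LD j _ _ (LD i _ _ FL)) x y)) _.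
  rewrite [leLHS]mulrA; apply: ler_wpM2r; first by []. by rewrite mulrC.
- move=> x; apply/matrixP => i j; rewrite !mxE rem_rem.
  congr (_ * (_ * moll _ _ _)); apply/funext => z; rewrite /D.
  rewrite (addrAC z (v i)); ring.
Qed.

End MollJet.

(** * The random walk comparison *)

Lemma ler_sum_ord (R : realType) (n : nat) (F : 'I_n -> R) (c : R) :
  (forall i, F i <= c) -> \sum_i F i <= n%:R * c.
Proof.
move=> Fc; rewrite mulr_natl -[n in leRHS]card_ord -sumr_const.
exact: ler_sum.
Qed.

Lemma closed_ball_compact (R : realType) (N : nat) (z : 'rV[R]_N) (r : R) :
  compact [set x : 'rV[R]_N | `|x - z| <= r].
Proof.
apply: bounded_closed_compact.
  exists (`|z| + r); split; first exact: num_real.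
  move=> M zM x /= xz; rewrite (le_trans _ (ltW zM))//.
  by rewrite -(subrK z x) addrC (le_trans (ler_normD _ _))// lerD2l.
have cN : continuous (fun x : 'rV[R]_N => `|x - z|).
  apply: (@lip_continuous _ _ 1) => // x y; rewrite mul1r.
  apply: le_trans (ler_dist_dist _ _) _.
  by rewrite opprB addrA subrK.
exact: (preimage_closed (fun x _ => cN x) (@closed_le R r)).
Qed.

Section Walk.
Variables (R : realType) (N k : nat) (a : 'I_k -> 'rV[R]_N).
Hypothesis k_gt0 : (0 < k)%N.
Hypothesis sqn_a : forall l, sqn (a l) = 1.
Implicit Types (x y z : 'rV[R]_N) (f phi F G : 'rV[R]_N -> R) (L K t : R).

Definition walk t f x : R :=
  (2 * k%:R)^-1 * \sum_l (f (x + t *: a l) + f (x - t *: a l)).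

(** For an orthonormal frame, the trace of [X] compressed to its span. *)
Definition lap (X : 'M[R]_N) : R := \sum_l qform X (a l).

Let k2 : 0 < 2 * k%:R :> R.
Proof. by rewrite mulr_gt0// ltr0n. Qed.

Let norm_a l : `|a l| <= 1.
Proof.
have := norm_sqn (a l); rewrite sqn_a => h.
by rewrite -(@expr_le1 _ 2)//.
Qed.

Lemma walk_cst t c x : walk t (fun=> c) x = c.
Proof.
rewrite /walk sumr_const card_ord -mulr_natl; field.
by rewrite pnatr_eq0 -lt0n.
Qed.

Lemma walkD t f g x : walk t (fun y => f y + g y) x = walk t f x + walk t g x.
Proof.
rewrite /walk -mulrDr -big_split /=; congr (_ * _).
by apply: eq_bigr => l _; ring.
Qed.

Lemma walkZ t f c x : walk t (fun y => c * f y) x = c * walk t f x.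
Proof.
rewrite /walk mulrCA; congr (_ * _); rewrite mulr_sumr.
by apply: eq_bigr => l _; ring.
Qed.

Lemma walk_le t f g x : (forall y, f y <= g y) -> walk t f x <= walk t g x.
Proof.
move=> fg; rewrite ler_pM2l ?invr_gt0//.
by apply: ler_sum => l _; apply: lerD.
Qed.

Lemma walk_leD t f g c x : (forall y, f y <= g y + c) -> walk t f x <= walk t g x + c.
Proof.
by move=> fg; rewrite -[in leRHS](walk_cst t c x) -walkD; exact: walk_le.
Qed.

Lemma iter_walk_leD t f g c n x :
  (forall y, f y <= g y + c) -> iter n (walk t) f x <= iter n (walk t) g x + c.
Proof.
move=> fg; elim: n x => [|n IH] x /=; first exact: fg.
exact: walk_leD.
Qed.

Lemma lip_walk t f L : lip L f -> lip L (walk t f).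
Proof.
move=> fL.
have H x y : walk t f x <= walk t f y + L * `|x - y|.
  rewrite -[in leRHS](walk_cst t (L * `|x - y|) y) -walkD.
  rewrite ler_pM2l ?invr_gt0//; apply: ler_sum => l _.
  have h1 := fL (x + t *: a l) (y + t *: a l).
  have h2 := fL (x - t *: a l) (y - t *: a l).
  rewrite opprD addrACA subrr addr0 in h1.
  rewrite opprD addrACA subrr addr0 in h2.
  have := le_trans (ler_norm _) h1; have := le_trans (ler_norm _) h2; lra.
move=> x y; rewrite ler_norml; have := H x y; have := H y x.
by rewrite (distrC y x); lra.
Qed.

Lemma lip_iter_walk t f L n : lip L f -> lip L (iter n (walk t) f).
Proof. by move=> fL; elim: n => //= n; exact: lip_walk. Qed.

Lemma walk_dist t f L x : 0 <= t -> 0 <= L -> lip L f -> `|walk t f x - f x| <= L * t.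
Proof.
move=> t0 L0 fL.
have B l (s : R) : s = t \/ s = - t -> `|f (x + s *: a l) - f x| <= L * t.
  move=> st; apply: le_trans (fL _ _) _; apply: ler_wpM2l => //.
  rewrite addrAC subrr add0r normrZ.
  have -> : `|s| = t by case: st => ->; rewrite ?normrN ger0_norm.
  by rewrite ler_piMr.
have h1 : walk t f x <= walk t (fun=> f x) x + L * t.
  rewrite -[in leRHS](walk_cst t (L * t) x) -walkD.
  rewrite ler_pM2l ?invr_gt0//; apply: ler_sum => l _.
  have := B l t (or_introl erefl); have := B l (- t) (or_intror erefl).
  rewrite scaleNr !ler_norml; lra.
have h2 : walk t (fun=> f x) x <= walk t f x + L * t.
  rewrite -[in leRHS](walk_cst t (L * t) x) -walkD.
  rewrite ler_pM2l ?invr_gt0//; apply: ler_sum => l _.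
  have := B l t (or_introl erefl); have := B l (- t) (or_intror erefl).
  rewrite scaleNr !ler_norml; lra.
rewrite !walk_cst in h1 h2; rewrite ler_norml; lra.
Qed.

Definition midconvex F := forall x y, 2 * F x <= F (x + y) + F (x - y).

Lemma midconvex_walk t F x : midconvex F -> F x <= walk t F x.
Proof.
move=> cF; rewrite -[leLHS](walk_cst t (F x) x) ler_pM2l ?invr_gt0//.
by apply: ler_sum => l _; have := cF x (t *: a l); lra.
Qed.

Lemma midconvex_iter_walk t F n x : midconvex F -> F x <= iter n (walk t) F x.
Proof.
move=> cF; elim: n x => // n IH x /=.
by apply: le_trans (midconvex_walk t x cF) _; exact: walk_le.
Qed.

Lemma walk_sqn t z x : walk t (fun y => sqn (y - z)) x = sqn (x - z) + t ^+ 2.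
Proof.
rewrite /walk (eq_bigr (fun=> 2 * (sqn (x - z) + t ^+ 2))); last first.
  move=> l _; rewrite (addrAC x (t *: a l)) (addrAC x (- (t *: a l))).
  move: (x - z) => w; rewrite !sqnD dotNr sqnN sqnZ sqn_a; ring.
rewrite sumr_const card_ord -[_ *+ k]mulr_natl; field.
by rewrite pnatr_eq0 -lt0n.
Qed.

Lemma moll_walk vs t F : is_lip F -> moll vs (walk t F) = walk t (moll vs F).
Proof.
move=> FL.
have [sL sE] := @moll_sum R N vs 'I_k (index_enum 'I_k)
  (fun l z => F (z + t *: a l) + F (z - t *: a l))
  (fun l => is_lipD (is_lip_shift _ FL) (is_lip_shift _ FL)).
rewrite /walk mollZ// sE; apply/funext => x; congr (_ * _); apply: eq_bigr => l _.
by rewrite mollD ?moll_shift//; exact: is_lip_shift.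
Qed.

Lemma moll_iter_walk vs t F n : is_lip F ->
  moll vs (iter n (walk t) F) = iter n (walk t) (moll vs F).
Proof.
move=> FL; elim: n => //= n IH; rewrite moll_walk ?IH//.
by case: FL => L L0 FL; exists L => //; exact: lip_iter_walk.
Qed.

Lemma jet_sum K (I : Type) (r : seq I) (phi : I -> 'rV[R]_N -> R) g X :
  (forall i, jet K (phi i) (g i) (X i)) ->
  jet ((size r)%:R * K) (fun x => \sum_(i <- r) phi i x)
   (fun x => \sum_(i <- r) g i x) (fun x => \sum_(i <- r) X i x).
Proof.
move=> J; elim: r => [|i r IH] /=.
  have := jet_affine (0 : 'rV[R]_N) (0 : R); rewrite mul0r.
  congr (jet _ _ _ _); apply/funext => x; rewrite ?big_nil//.
  by rewrite addr0 dot0l.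
rewrite -natr1 mulrDl mul1r addrC.
have := jetD (J i) IH.
by congr (jet _ _ _ _); apply/funext => x; rewrite ?big_cons.
Qed.

Lemma lapD X Y : lap (X + Y) = lap X + lap Y.
Proof. by rewrite /lap -big_split; apply: eq_bigr => l _; rewrite qformD. Qed.

Lemma lapZ c X : lap (c *: X) = c * lap X.
Proof. by rewrite /lap mulr_sumr; apply: eq_bigr => l _; rewrite qformZ. Qed.

Lemma lap_scalar c : lap c%:M = k%:R * c.
Proof.
rewrite /lap (eq_bigr (fun=> c)); first by rewrite sumr_const card_ord mulr_natl.
by move=> l _; rewrite qform_scalar sqn_a mulr1.
Qed.

Lemma lap_sum (I : Type) (r : seq I) (X : I -> 'M[R]_N) :
  lap (\sum_(i <- r) X i) = \sum_(i <- r) lap (X i).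
Proof.
elim: r => [|i r IH]; last by rewrite !big_cons lapD IH.
by rewrite !big_nil -(scale0r 0) lapZ mul0r.
Qed.

(** Being an average of shifts, the walk keeps the constant [K]. Hence the Taylor errors are uniform
    in the number of iterations. *)
Lemma jet_walk t K phi g X : jet K phi g X -> exists g' X',
  jet K (walk t phi) g' X' /\ forall x, lap (X' x) = walk t (lap \o X) x.
Proof.
move=> J.
have Jl l := jetD (jet_shift (t *: a l) J) (jet_shift (- (t *: a l)) J).
have := jetZ (2 * k%:R)^-1 (jet_sum (index_enum 'I_k) Jl).
have -> : size (index_enum 'I_k) = k by rewrite -sum1_size sum1_card card_ord.
have -> : `|(2 * k%:R)^-1| * (k%:R * (K + K)) = K.
  rewrite gtr0_norm ?invr_gt0//; field.
  by rewrite pnatr_eq0 -lt0n.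
move=> JJ; eexists; eexists; split; first exact: JJ.
move=> x; rewrite lapZ lap_sum /walk; congr (_ * _); apply: eq_bigr => l _.
by rewrite lapD.
Qed.

Lemma walk_taylor t K phi g X x : 0 <= t -> jet K phi g X ->
  `|walk t phi x - phi x - t ^+ 2 / (2 * k%:R) * lap (X x)| <=
  t ^+ 2 / (2 * k%:R) * (k%:R * jet_const N K * t).
Proof.
move=> t0 J.
have k0 : k%:R != 0 :> R by rewrite pnatr_eq0 -lt0n.
have -> : walk t phi x - phi x - t ^+ 2 / (2 * k%:R) * lap (X x) =
  (2 * k%:R)^-1 * \sum_l (phi (x + t *: a l) + phi (x - t *: a l) - 2 * phi x -
    qform (X x) (t *: a l)).
  rewrite !sumrB sumr_const card_ord.
  have -> : \sum_l qform (X x) (t *: a l) = t ^+ 2 * lap (X x).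
    rewrite /lap mulr_sumr; apply: eq_bigr => l _.
    rewrite /qform mulr_sumr; apply: eq_bigr => i _.
    rewrite mxE expr2 -!mulrA; congr (_ * _).
    rewrite mulrCA; congr (_ * _); rewrite mulr_sumr; apply: eq_bigr => j _.
    by rewrite mxE mulrA.
  by rewrite -[_ *+ k]mulr_natl /walk; field.
rewrite normrM gtr0_norm ?invr_gt0//.
rewrite [leRHS](_ : _ = (2 * k%:R)^-1 * (t ^+ 2 * (k%:R * jet_const N K * t))); last by ring.
rewrite ler_pM2l ?invr_gt0//.
apply: le_trans (ler_norm_sum _ _ _) _.
have -> : t ^+ 2 * (k%:R * jet_const N K * t) = \sum_(l < k) (jet_const N K * t ^+ 3).
  by rewrite sumr_const card_ord -[RHS]mulr_natl; ring.
apply: ler_sum => l _; apply: le_trans (jet_second_diff _ _ J) _.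
have C0 : 0 <= jet_const N K.
  by rewrite /jet_const !mulr_ge0// ?addr_ge0//; exact: jet_K J.
apply: ler_wpM2l => //; rewrite lerXn2r ?nnegrE// normrZ ger0_norm//.
by rewrite ler_piMr.
Qed.

Lemma lap_lip K phi g X : jet K phi g X ->
  0 <= k%:R * (N%:R * (N%:R * K)) /\ lip (k%:R * (N%:R * (N%:R * K))) (lap \o X).
Proof.
move=> J; have K0 := jet_K J; split; first by rewrite !mulr_ge0.
move=> x y /=; rewrite /lap -sumrB.
have ai l i : `|a l 0 i| <= 1 by apply: le_trans (coord_le_norm _ _) _.
apply: le_trans (ler_norm_sum _ _ _) _.
rewrite -!mulrA; apply: ler_sum_ord => l.
rewrite /qform -sumrB; apply: le_trans (ler_norm_sum _ _ _) _.
apply: ler_sum_ord => i.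
rewrite -mulrBr normrM -sumrB.
apply: le_trans (_ : _ <= 1 * _) _; last by rewrite mul1r.
apply: ler_pM => //; apply: le_trans (ler_norm_sum _ _ _) _.
apply: ler_sum_ord => j.
rewrite -mulrBr normrM -[leRHS]mul1r; apply: ler_pM => //.
by have [_ /(_ x y)] := jet_hess J i j; rewrite !mxE.
Qed.

End Walk.

(** * From a viscosity inequality for a function to its mollifications *)

Section Core.
Variables (R : realType) (N k : nat) (a : 'I_k -> 'rV[R]_N).
Hypothesis k_gt0 : (0 < k)%N.
Hypothesis sqn_a : forall l, sqn (a l) = 1.
Variables (F : 'rV[R]_N -> R) (L : R).
Hypothesis L_ge0 : 0 <= L.
Hypothesis F_lip : lip L F.
Hypothesis F_convex : midconvex F.
Variables (c r : R) (x0 : 'rV[R]_N).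
Hypothesis r_gt0 : 0 < r.
Hypothesis F_visc : forall y phi g X K, `|y - x0| < 2 * r -> jet K phi g X ->
  phi y = F y -> (\forall y' \near y, F y' <= phi y') -> c <= lap a (X y).

Let k0 : 0 < k%:R :> R. Proof. by rewrite ltr0n. Qed.

Lemma iter_jet t K phi g X n : jet K phi g X ->
  exists g' X', jet K (iter n (walk a t) phi) g' X'.
Proof.
move=> J; elim: n => [|n [g' [X' Jn]]] /=; first by exists g, X.
by have [g'' [X'' [J' _]]] := jet_walk a k_gt0 t Jn; exists g'', X''.
Qed.

(* Induction on [n]: at a maximum point of the difference the right-hand side
   touches [F] from above, which bounds [lap] of the smooth function
   [iter n (walk a t) phi] from below, i.e. its increase over one step; the
   quadratic term keeps the maximum in the region where [F_visc] holds, and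
   outside it convexity of [F] suffices. *)
Lemma walk_comparison K phi g X (e eta D t : R) (z : 'rV[R]_N) n :
  jet K phi g X -> (forall x, F x <= phi x + e) ->
  0 <= t -> 0 <= D -> c - eta <= D * r ^+ 2 ->
  t * (k%:R * jet_const N K + k%:R * (N%:R * (N%:R * K))) <= eta / 2 ->
  n%:R * t ^+ 2 * D <= eta / 2 -> `|z - x0| < r ->
  forall x, F x <= iter n (walk a t) phi x
    - n%:R * (t ^+ 2 / (2 * k%:R)) * (c - eta - D * sqn (x - z)) + e.
Proof.
move=> J Fphi t0 D0 Dr teta + zx0.
set s := t ^+ 2 / (2 * k%:R).
have s0 : 0 <= s by rewrite divr_ge0 ?sqr_ge0// mulr_ge0// ltW.
have sE : s * (2 * k%:R) = t ^+ 2 by rewrite /s divfK// gt_eqF// mulr_gt0.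
elim: n => [|n IH] nD; first by move=> x; rewrite mul0r mul0r subr0; exact: Fphi.
have {}IH : forall x, F x <= iter n (walk a t) phi x
    - n%:R * s * (c - eta - D * sqn (x - z)) + e.
  apply: IH; apply: le_trans nD; rewrite !ler_wpM2r ?sqr_ge0// ler_nat.
  exact: leqnSn.
have [gn [Xn Jn]] := iter_jet t n J.
have [gm [Xm [Jm lapXm]]] := jet_walk a k_gt0 t Jn.
set w := iter n (walk a t) phi in IH Jn Jm *.
rewrite iterS -/w; set m := n.+1 in nD *.
have m0 : 0 <= m%:R * s by rewrite mulr_ge0.
have far x : r <= `|x - z| ->
    F x <= walk a t w x - m%:R * s * (c - eta - D * sqn (x - z)) + e.
  move=> xz.
  have h1 : F x <= iter m (walk a t) F x by exact: midconvex_iter_walk.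
  have h2 : iter m (walk a t) F x <= iter m (walk a t) phi x + e by exact: iter_walk_leD.
  have h3 : r ^+ 2 <= sqn (x - z).
    by apply: le_trans (norm_sqn _); rewrite lerXn2r ?nnegrE// ltW.
  have h4 : D * r ^+ 2 <= D * sqn (x - z) by rewrite ler_wpM2l.
  have h5 : 0 <= m%:R * s * (D * sqn (x - z) - (c - eta)) by rewrite mulr_ge0//; lra.
  have := le_trans h1 h2; rewrite iterS -/w; lra.
pose psi x := F x + (-1) * walk a t w x + (- (m%:R * s * D)) * sqn (x - z).
have psic : continuous psi.
  have c1 := lip_continuous L_ge0 F_lip.
  have c2 := jet_cont (jetZ (-1) Jm).
  have c3 := jet_cont (jetZ (- (m%:R * s * D)) (jet_shift (- z) (jet_sqn R N))).
  move=> x; apply: (@continuousD R R^o _ (fun y => F y + (-1) * walk a t w y)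
    (fun y => - (m%:R * s * D) * sqn (y - z))); last exact: c3.
  by apply: (@continuousD R R^o _ F); [exact: c1|exact: c2].
have [|||y yB ymax] := @compact_EVT_max _ R psi [set x | `|x - z| <= r].
- by exists z; rewrite /= subrr normr0 ltW.
- exact: closed_ball_compact.
- exact: continuous_subspaceT.
rewrite inE /= in yB.
suff good : F y <= walk a t w y - m%:R * s * (c - eta - D * sqn (y - z)) + e.
  move=> x; have [xz|xz] := leP r `|x - z|; first exact: far.
  have : psi x <= psi y by apply: ymax; rewrite inE /= ltW.
  rewrite /psi; lra.
have [yz|yz] := leP r `|y - z|; first exact: far.
have Jt := jetD (jetD Jm (jetZ (m%:R * s * D) (jet_shift (- z) (jet_sqn R N))))
  (jet_affine 0 (psi y)).
have yx0 : `|y - x0| < 2 * r.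
  rewrite -(subrKA z) (le_lt_trans (ler_normD _ _))//; lra.
have := F_visc yx0 Jt; rewrite dot0l => /(_ _ _)/wrap[||].
- rewrite /psi; ring.
- have : \forall y' \near y, `|y' - y| < r - `|y - z| by apply: near_norm; lra.
  apply: filterS => y' yy'; rewrite dot0l.
  have : psi y' <= psi y.
    apply: ymax; rewrite inE /= -(subrKA y) (le_trans (ler_normD _ _))//; lra.
  rewrite /psi; lra.
rewrite addr0 lapD lapXm lapZ lap_scalar// => cl.
have [Lam0 Laml] := lap_lip sqn_a Jn.
have W := walk_dist k_gt0 sqn_a y t0 Lam0 Laml.
have T := walk_taylor k_gt0 sqn_a y t0 Jn.
rewrite -/s in T.
have E : m%:R * s * D * (k%:R * 2) = m%:R * t ^+ 2 * D by rewrite -sE; ring.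
rewrite -/w /= in W.
(* The test Hessian has [lap] equal to a walk of the [lap] of the previous iterate plus
   [m%:R * t ^+ 2 * D]. Undoing the walk, the penalty and the Taylor error together cost [eta]. *)
have key : s * (c - eta) <= walk a t w y - w y.
  have h : c - eta <= lap a (Xn y) - k%:R * jet_const N K * t.
    move: W nD teta; rewrite -E ler_norml /comp; lra.
  have h' := ler_wpM2l s0 h.
  move: T; rewrite ler_norml -/w; lra.
have := IH y.
have Dn : 0 <= s * (D * sqn (y - z)) by rewrite !mulr_ge0// sqn_ge0.
rewrite /m -natr1; lra.
Qed.

(** Over a fixed time s = n t^2 the comparison bounds from below the increase of F under n steps of
    the walk, and this survives averaging. Taylor expansion of the smooth average bounds its
    increase from above by s / (2 k) times [lap], up to small errors; dividing by that factor gives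
    the claim. *)
Lemma moll_visc d K g X x : 0 < d -> jet K (moll (axes N d) F) g X ->
  `|x - x0| + 2 * N%:R * d < r -> c <= lap a (X x).
Proof.
move=> d0 J xr; apply/ler_addgt0Pr => e e0.
(* The losses are [eta] in the comparison, [eta] from the mollification error [eps], [2 * eta] in
   the Taylor bound and [eta / 2] from the spreading of the walk. *)
pose eta := e / 5.
have eta0 : 0 < eta by rewrite divr_gt0.
set G := moll (axes N d) F in J.
have [Lam0 Laml] := lap_lip sqn_a J.
set Lam := k%:R * _ in Lam0 Laml.
pose D := `|c| / r ^+ 2.
have D0 : 0 <= D by rewrite divr_ge0// sqr_ge0.
have Dr : c - eta <= D * r ^+ 2.
  rewrite /D divfK ?gt_eqF ?exprn_gt0//.
  have := ler_norm c; lra.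
(* Young's inequality replaces the Lipschitz bound by a square, whose walk is computed exactly. *)
pose D' := Lam ^+ 2 / (4 * eta).
have D'0 : 0 <= D' by rewrite divr_ge0 ?sqr_ge0//; lra.
have LamD y : Lam * y <= eta + D' * y ^+ 2.
  have -> : eta + D' * y ^+ 2 = Lam * y + (Lam * y / 2 - eta) ^+ 2 / eta.
    by rewrite /D'; field; rewrite gt_eqF.
  by rewrite lerDl divr_ge0 ?sqr_ge0// ltW.
(* The time [s] is fixed first. It determines the accuracy [eps], hence the scale [th], hence the
   jet constant [K1]; the step [t] comes last and must be small against [K1]. *)
pose s := eta / (2 * (D + D' + 1)).
have s0 : 0 < s by rewrite divr_gt0//; lra.
have sE : s * (D + D' + 1) = eta / 2 by rewrite /s; field; lra.
have sD : s * D <= eta / 2.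
  have : 0 <= s * D' by rewrite mulr_ge0// ltW.
  lra.
have sD' : s * D' <= eta / 2.
  have : 0 <= s * D by rewrite mulr_ge0// ltW.
  lra.
pose eps := s / (2 * k%:R) * eta / 2.
have eps0 : 0 < eps by rewrite !divr_gt0// mulr_gt0// divr_gt0// mulr_gt0.
pose th := eps / (L * (2 * N%:R) + 1).
have th0 : 0 < th.
  by rewrite divr_gt0// ltr_wpDl// !mulr_ge0.
have Lth : L * (2 * N%:R * th) <= eps.
  rewrite /th; set q := L * (2 * N%:R).
  have q0 : 0 <= q by rewrite !mulr_ge0.
  have -> : L * (2 * N%:R * (eps / (q + 1))) = q / (q + 1) * eps by rewrite /q; ring.
  by rewrite ler_piMl ?(ltW eps0)// ler_pdivrMr; lra.
have [K1 [g1 [X1 J1]]] := jet_moll th0 L_ge0 F_lip.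
set phi := moll (axes N th) F in J1.
have Fphi y : `|phi y - F y| <= eps.
  apply: le_trans (moll_dist _ y L_ge0 F_lip) _; apply: le_trans Lth.
  by apply: ler_wpM2l => //; apply: axes_norm; exact: ltW.
set C1 := k%:R * jet_const N K1 + k%:R * (N%:R * (N%:R * K1)).
set C := k%:R * jet_const N K.
have jc M : 0 <= M -> 0 <= jet_const N M.
  by move=> M0; rewrite !mulr_ge0// addr_ge0.
have C10 : 0 <= C1 by rewrite addr_ge0 ?mulr_ge0 ?jc ?(jet_K J1).
have C0 : 0 <= C by rewrite mulr_ge0 ?jc ?(jet_K J).
pose t0 := eta / (2 * (C1 + C + 1)).
have t00 : 0 < t0 by rewrite divr_gt0//; lra.
have t0E : t0 * (C1 + C + 1) = eta / 2 by rewrite /t0; field; lra.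
pose n := (Num.truncn (s / t0 ^+ 2)).+1.
have nn : s / t0 ^+ 2 < n%:R by exact: truncnS_gt.
have n0 : 0 < n%:R :> R by rewrite ltr0n.
(* This makes n t^2 equal to [s] exactly, with [n] so large that [t <= t0]. *)
pose t := Num.sqrt (s / n%:R).
have t_ge0 : 0 <= t by exact: sqrtr_ge0.
have t2 : t ^+ 2 = s / n%:R by rewrite sqr_sqrtr// divr_ge0 ?ltW.
have nt2 : n%:R * t ^+ 2 = s by rewrite t2 mulrC divfK// gt_eqF.
have tt0 : t <= t0.
  rewrite -[leRHS](@ger0_norm _ t0) ?(ltW t00)// -sqrtr_sqr ler_wsqrtr//.
  by rewrite ler_pdivrMr// mulrC -ler_pdivrMr ?exprn_gt0// ltW.
have tC1 : t * C1 <= eta / 2.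
  have h1 : t * C1 <= t0 * C1 by rewrite ler_wpM2r.
  have : 0 <= t0 * C by rewrite mulr_ge0// ltW.
  lra.
have tC : t * C <= eta.
  have h1 : t * C <= t0 * C by rewrite ler_wpM2r.
  have : 0 <= t0 * C1 by rewrite mulr_ge0// ltW.
  lra.
set sg := t ^+ 2 / (2 * k%:R).
have sg0 : 0 <= sg by rewrite divr_ge0 ?sqr_ge0// mulr_ge0// ltW.
have nsg : n%:R * sg = s / (2 * k%:R) by rewrite /sg mulrA nt2.
(* The penalty is centred at the point of evaluation, where it vanishes. *)
have low z : `|z - x0| < r ->
    F z <= iter n (walk a t) F z + (2 * eps - s / (2 * k%:R) * (c - eta)).
  move=> zx0.
  have Fphi' y : F y <= phi y + eps by have := Fphi y; rewrite ler_norml; lra.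
  have nD : n%:R * t ^+ 2 * D <= eta / 2 by rewrite nt2.
  have := walk_comparison J1 Fphi' t_ge0 D0 Dr tC1 nD zx0 z.
  rewrite subrr -/sg nsg sqn0 mulr0 subr0.
  have := @iter_walk_leD R N k a k_gt0 t phi F eps n z.
  move=> /(_ _)/wrap[y|]; first by have := Fphi y; rewrite ler_norml; lra.
  lra.
have FL : is_lip F by exists L.
have low' : G x <= iter n (walk a t) G x + (2 * eps - s / (2 * k%:R) * (c - eta)).
  rewrite -moll_iter_walk//; apply: moll_le => // [|y yx].
    by exists L => //; exact: lip_iter_walk.
  apply: low; rewrite -(subrKA x); apply: le_lt_trans (ler_normD _ _) _.
  have := axes_norm N (ltW d0); lra.
set l := lap a (X x).
(* Each step of the walk raises |y - x|^2 by t^2 on average; this accumulates to the last term. *)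
have up m y : iter m (walk a t) G y <=
    G y + m%:R * sg * (l + 2 * eta + D' * sqn (y - x) + D' * (m%:R * t ^+ 2)).
  elim: m y => [|m IH] y; first by rewrite !mul0r addr0.
  rewrite iterS.
  set A := l + 2 * eta + D' * (m%:R * t ^+ 2).
  have h1 : walk a t (iter m (walk a t) G) y <=
      walk a t (fun y => G y + m%:R * sg * (A + D' * sqn (y - x))) y.
    apply: walk_le => // y'; apply: le_trans (IH y') _; rewrite /A.
    rewrite lerD2l; apply: ler_wpM2l; [exact: mulr_ge0|lra].
  rewrite !walkD walkZ walkD walkZ walk_cst// walk_sqn// in h1.
  have T := walk_taylor k_gt0 sqn_a y t_ge0 J.
  rewrite -/sg -/G -/C in T.
  have lX : lap a (X y) <= l + eta + D' * sqn (y - x).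
    have := Laml y x; rewrite /= -/l ler_norml.
    have := LamD `|y - x|.
    have := ler_wpM2l D'0 (norm_sqn (y - x)); lra.
  have h2 := ler_wpM2l sg0 lX.
  have h3 : sg * (C * t) <= sg * eta by rewrite ler_wpM2l// mulrC.
  have h4 : 0 <= sg * (D' * (m.+1%:R * t ^+ 2)) by do !apply: mulr_ge0 => //; exact: sqr_ge0.
  move: T; rewrite ler_norml => T.
  rewrite -natr1 in h4 *; rewrite /A in h1; lra.
have := up n x.
rewrite subrr sqn0 nt2 nsg => up'.
have q0 : 0 < s / (2 * k%:R) by rewrite divr_gt0// mulr_gt0.
have : s / (2 * k%:R) * (c - eta - eta) <= s / (2 * k%:R) * (l + 2 * eta + D' * s).
  rewrite /eps in low'; lra.
rewrite ler_pM2l// /eta in sD' *; rewrite /eta; lra.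
Qed.

End Core.

(** * The sum of the k smallest eigenvalues *)

Section Spectral.
Variable (R : realType).

Lemma dot_mx n (x y : 'rV[R]_n) : x *m y^T = (dot x y)%:M.
Proof.
apply/matrixP => i j; rewrite !ord1 !mxE eqxx mulr1n.
by apply: eq_bigr => l _; rewrite mxE.
Qed.

Lemma qform_mx n (X : 'M[R]_n) (y : 'rV[R]_n) : qform X y = dot y (y *m X^T).
Proof.
apply: eq_bigr => i _; congr (_ * _); rewrite mxE.
by apply: eq_bigr => j _; rewrite mxE.
Qed.

(* The reflection exchanging [v] and the first basis vector. *)
Lemma householder n (v : 'rV[R]_n.+1) : sqn v = 1 ->
  exists2 H : 'M[R]_n.+1, H *m H^T = 1%:M & row 0 H = v.
Proof.
move=> v1; pose e : 'rV[R]_n.+1 := delta_mx 0 0.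
have [ve|ve] := eqVneq v e.
  exists 1%:M; first by rewrite trmx1 mulmx1.
  by rewrite rowE mulmx1 ve.
pose w := e - v; pose c := sqn w.
have cE : c = 2 * (1 - v 0 0).
  rewrite /c /w sqnD sqnN dotNr v1 /e sqn_delta dotC dot_delta; ring.
have c0 : c != 0.
  apply/eqP => c0; move/eqP: ve; apply; apply/rowP => i.
  have := norm_sqn w; rewrite -/c c0 => h.
  have /eqP : `|w| = 0 by apply/eqP; rewrite -sqrf_eq0 eq_le h sqr_ge0.
  by rewrite normr_eq0 subr_eq0 => /eqP ->.
exists (1%:M - (2 / c) *: (w^T *m w)).
  have -> : (1%:M - (2 / c) *: (w^T *m w))^T = 1%:M - (2 / c) *: (w^T *m w).
    by rewrite [LHS]raddfB /= trmx1 [X in _ - X]linearZ /= trmx_mul trmxK.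
  have AA : (w^T *m w) *m (w^T *m w) = c *: (w^T *m w).
    by rewrite mulmxA -(mulmxA w^T) dot_mx mul_mx_scalar -/c -scalemxAl.
  move: (w^T *m w) AA => A AA.
  rewrite mulmxBl mul1mx mulmxBr mulmx1 -scalemxAl -scalemxAr AA !scalerA.
  have -> : 2 / c * (2 / c) * c = 2 / c + 2 / c by field.
  by rewrite scalerDl opprB addrK subrK.
rewrite rowE mulmxBr mulmx1 -scalemxAr mulmxA dot_mx mul_scalar_mx scalerA.
rewrite -/e (_ : 2 / c * _ = 1) ?scale1r /w ?subKr//.
have -> : dot e (e - v) = c / 2.
  by rewrite cE dotC /e dot_delta !mxE !eqxx /=; field.
by field.
Qed.

(** Deflation: the split characteristic polynomial supplies a real eigenvalue, a reflection
    exchanges a unit eigenvector with the first axis, and the complementary block is symmetric of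
    smaller size. *)
Lemma sym_diag n (X : 'M[R]_n) : X^T = X -> exists (Q : 'M[R]_n) (d : 'rV[R]_n),
  Q *m Q^T = 1%:M /\ Q *m X *m Q^T = diag_mx d.
Proof.
elim: n X => [|n IH] X Xs.
  by exists 1%:M, 0; split; apply/matrixP => -[].
have [s sE] := char_poly_sym_split Xs.
have [b bX] : exists b, eigenvalue X b.
  case: s sE => [|b s] sE.
    have := size_char_poly X; rewrite sE big_nil size_poly1 => /eqP.
    by rewrite eqSS.
  exists b; rewrite eigenvalue_root_char sE big_cons rootM root_XsubC eqxx//.
have [u uX u0] := eigenvalueP bX.
have [v vX v1] : exists2 v : 'rV[R]_n.+1, v *m X = b *: v & sqn v = 1.
  have su : 0 < sqn u.
    rewrite lt_neqAle sqn_ge0 andbT eq_sym; apply: contraNneq u0 => su.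
    rewrite -normr_eq0 -sqrf_eq0 eq_le sqr_ge0 andbT -su; exact: norm_sqn.
  exists ((Num.sqrt (sqn u))^-1 *: u).
    by rewrite -scalemxAl uX scalerA mulrC -scalerA.
  by rewrite sqnZ exprVn sqr_sqrtr ?(ltW su)// mulVf// gt_eqF.
have [H HH Hv] := householder v1.
have [Y YE] : exists Y : 'M[R]_(1 + n), Y = H *m X *m H^T by eexists.
have Ys : Y^T = Y by rewrite YE !trmx_mul trmxK Xs mulmxA.
have Y0 : row 0 Y = b *: delta_mx 0 0.
  rewrite YE !row_mul Hv vX -scalemxAl -Hv -row_mul HH.
  by rewrite rowE mulmx1.
have Yul : ulsubmx Y = b%:M.
  apply/matrixP => i j; rewrite !ord1 !mxE eqxx mulr1n.
  have := congr1 (fun z : 'rV[R]_n.+1 => z 0 0) Y0; rewrite !mxE eqxx /= mulr1 => <-.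
  by congr (Y _ _); apply/val_inj.
have Yur : ursubmx Y = 0.
  apply/matrixP => i j; rewrite !ord1 !mxE.
  have := congr1 (fun z : 'rV[R]_n.+1 => z 0 (rshift 1 j)) Y0.
  rewrite !mxE /= mulr0 => <-.
  by congr (Y _ _); apply/val_inj.
have Ydl : dlsubmx Y = 0 by rewrite -Ys -trmx_ursub Yur trmx0.
have Ydr : (drsubmx Y)^T = drsubmx Y by rewrite trmx_drsub Ys.
have [Q [d [QQ Qd]]] := IH _ Ydr.
pose P : 'M[R]_(1 + n) := block_mx 1%:M 0 0 Q.
have PT : P^T = block_mx 1%:M 0 0 Q^T by rewrite tr_block_mx trmx1 !trmx0.
have PP : P *m P^T = 1%:M.
  rewrite PT /P mulmx_block !mul0mx !mulmx0 mulmx1 addr0 !add0r QQ.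
  by rewrite -scalar_mx_block.
have PYP : P *m Y *m P^T = diag_mx (row_mx b%:M d).
  rewrite PT /P -[Y]submxK Yul Yur Ydl !mulmx_block !mul0mx !mulmx0.
  rewrite !mul1mx !mulmx1 !addr0 !add0r !mul0mx ?mulmx0 ?addr0 Qd diag_mx_row.
  by congr block_mx; apply/matrixP => i j; rewrite !ord1 !mxE.
exists (P *m H), (row_mx b%:M d); split.
  by rewrite trmx_mul mulmxA -(mulmxA P) HH mulmx1; exact: PP.
rewrite trmx_mul !mulmxA -(mulmxA P) -(mulmxA P).
by have := PYP; rewrite YE mulmxA.
Qed.

(** The diagonal entries and [eigvals X] are the roots of one polynomial, so a permutation relabels
    the orthonormal rows in the order of [eigvals X]. *)
Lemma eigen_basis n (X : 'M[R]_n) : X^T = X -> exists q : 'I_n -> 'rV[R]_n,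
  [/\ forall i j, dot (q i) (q j) = (i == j)%:R,
      forall y, sqn y = \sum_i dot y (q i) ^+ 2
    & forall y, qform X y = \sum_(i < n) (eigvals X)`_i * dot y (q i) ^+ 2].
Proof.
move=> Xs; have [Q [d [QQ Qd]]] := sym_diag Xs.
have QQ' : Q^T *m Q = 1%:M by exact: mulmx1C.
have [[ss sE] sz] := eigvals_sym Xs.
have cE : char_poly X = \prod_i ('X - (d 0 i)%:P).
  have PV : map_mx polyC Q *m map_mx polyC Q^T = 1%:M.
    by rewrite -map_mxM QQ map_mx1.
  have -> : char_poly X = char_poly (diag_mx d).
    rewrite -Qd /char_poly.
    have -> : char_poly_mx (Q *m X *m Q^T) =
        map_mx polyC Q *m char_poly_mx X *m map_mx polyC Q^T.
      rewrite /char_poly_mx mulmxBr mulmxBl !map_mxM /= scalar_mxC.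
      by rewrite -[X in _ = X - _]mulmxA PV mulmx1.
    by rewrite !det_mulmx mulrAC -det_mulmx PV det1 mul1r.
  rewrite char_poly_trig ?diag_mx_is_trig//.
  by apply: eq_bigr => i _; rewrite mxE eqxx mulr1n.
pose D := [tuple d 0 i | i < n].
have pD : perm_eq (eigvals X) D.
  apply: prod_XsubC_eq; rewrite -sE cE big_map big_enum /=.
  by apply: eq_bigr.
have /tuple_permP[sg sgE] : perm_eq (eigvals X) D by [].
have sgi (i : 'I_n) : (eigvals X)`_i = d 0 (sg i).
  by rewrite sgE -(tnth_nth 0 [tuple tnth D (sg i) | i < n]) !tnth_mktuple.
have dotQ a b : dot (row a Q) (row b Q) = (a == b)%:R.
  have := congr1 (fun M : 'M[R]_n => M a b) QQ; rewrite !mxE => <-.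
  by apply: eq_bigr => l _; rewrite !mxE.
have zE (y : 'rV[R]_n) j : (y *m Q^T) 0 j = dot y (row j Q).
  by rewrite mxE; apply: eq_bigr => l _; rewrite !mxE.
have dot00 (x y : 'rV[R]_n) : dot x y = (x *m y^T) 0 0.
  by rewrite dot_mx mxE eqxx mulr1n.
have XE : X = Q^T *m diag_mx d *m Q.
  by rewrite -Qd !mulmxA QQ' mul1mx -mulmxA QQ' mulmx1.
exists (fun i => row (sg i) Q); split => [i j|y|y].
- by rewrite dotQ (inj_eq perm_inj).
- have -> : sqn y = sqn (y *m Q^T).
    by rewrite /sqn !dot00 trmx_mul trmxK !mulmxA -(mulmxA y) QQ' mulmx1.
  rewrite [LHS](reindex_inj (@perm_inj _ sg)) /=.
  by apply: eq_bigr => i _; rewrite !zE -expr2.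
- have -> : qform X y = dot (y *m Q^T) (y *m Q^T *m diag_mx d).
    rewrite qform_mx {1}Xs {1}XE !dot00 !trmx_mul !trmxK tr_diag_mx.
    by rewrite !mulmxA.
  rewrite [LHS](reindex_inj (@perm_inj _ sg)) /=.
  apply: eq_bigr => i _; rewrite sgi mul_mx_diag [X in _ * X]mxE !zE; ring.
Qed.

End Spectral.

Section KyFan.
Variables (R : realType) (N k : nat) (X : 'M[R]_N).
Hypothesis Xs : X^T = X.
Hypothesis kN : (0 < k <= N)%N.

(** Ky Fan's principle: in the eigenbasis the trace is a sum of eigenvalues with weights in [0, 1]
    of total [k], which is least when all the weight is on the first [k]. *)
Lemma Pminus_le_lap (a : 'I_k -> 'rV[R]_N) :
  (forall l m, dot (a l) (a m) = (l == m)%:R) -> Pminus k X <= lap a X.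
Proof.
move=> aa; have [q [qq qs qX]] := eigen_basis Xs.
have [[ss _] sz] := eigvals_sym Xs.
set s := eigvals X in qX ss sz *.
pose w i := \sum_l dot (a l) (q i) ^+ 2.
have sw : \sum_i w i = k%:R.
  rewrite exchange_big /= (eq_bigr (fun=> 1)) ?sumr_const ?card_ord// => l _.
  by rewrite -qs /sqn aa eqxx.
have w0 i : 0 <= w i by apply: sumr_ge0 => l _; exact: sqr_ge0.
have w1 i : w i <= 1.
  (* Bessel's inequality: [z] is the projection of [q i] onto the span of the frame. *)
  pose z := \sum_l dot (a l) (q i) *: a l.
  have dz y : dot y z = \sum_l dot (a l) (q i) * dot y (a l).
    rewrite /z; elim/big_rec2: _ => [|l u v _ IH]; first by rewrite dotC dot0l.
    by rewrite dotDr dotZr IH.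
  have dqz : dot (q i) z = w i.
    by rewrite dz; apply: eq_bigr => l _; rewrite (dotC (q i)) expr2.
  have zz : sqn z = w i.
    rewrite {1}/sqn dz; apply: eq_bigr => l _; rewrite expr2; congr (_ * _).
    rewrite dotC dz (bigD1 l)//= aa eqxx mulr1 big1 ?addr0// => m ml.
    by rewrite aa eq_sym (negbTE ml) mulr0.
  have := sqn_ge0 (q i - z).
  rewrite sqnD sqnN dotNr dqz zz /sqn qq eqxx mulr1n; lra.
have -> : lap a X = \sum_(i < N) s`_i * w i.
  rewrite /lap; under eq_bigr do rewrite qX.
  rewrite exchange_big /=; apply: eq_bigr => i _; by rewrite -mulr_sumr.
case/andP: kN => k0 kleN.
have -> : Pminus k X = \sum_(i < N) s`_i * (i < k)%:R.
  rewrite /Pminus -/s (big_ord_widen N (fun i => s`_i))// big_mkcond /=.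
  by apply: eq_bigr => i _; case: ifP; rewrite ?mulr1 ?mulr0.
have sk : \sum_(i < N) (i < k)%:R = k%:R :> R.
  have -> : \sum_(i < N) (i < k)%:R = \sum_(i < N | (i < k)%N) (1 : R).
    by rewrite [RHS]big_mkcond; apply: eq_bigr => i _; case: ifP.
  by rewrite -(big_ord_widen N (fun=> 1))// sumr_const card_ord.
rewrite -subr_ge0 -sumrB.
(* Both weights have total [k], so subtracting a constant from the eigenvalues changes nothing. With
   the [k]-th eigenvalue, at index [k.-1], no term is negative. *)
have -> : \sum_(i < N) (s`_i * w i - s`_i * (i < k)%:R) =
    \sum_(i < N) (s`_i - s`_k.-1) * (w i - (i < k)%:R).
  apply/eqP; rewrite -subr_eq0 -sumrB.
  rewrite (eq_bigr (fun i : 'I_N => s`_k.-1 * (w i - (i < k)%:R))); last first.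
    by move=> i _; ring.
  by rewrite -mulr_sumr sumrB sw sk subrr mulr0.
have smono i j : (i <= j)%N -> (j < N)%N -> s`_i <= s`_j.
  move=> ij jN; apply: (sorted_leq_nth (@le_trans _ _) (@lexx _ _) 0 ss) => //.
  - by rewrite inE sz (leq_ltn_trans ij).
  - by rewrite inE sz.
apply: sumr_ge0 => i _; case: ltnP => ik /=.
  apply: mulr_le0; rewrite subr_le0 ?w1//.
  by apply: smono; rewrite ?(leq_trans _ kleN) ?prednK// -ltnS prednK.
rewrite subr0 mulr_ge0// subr_ge0 smono//.
by rewrite (leq_trans (leq_pred k)).
Qed.

Lemma Pminus_attained : exists2 a : 'I_k -> 'rV[R]_N,
  (forall l m, dot (a l) (a m) = (l == m)%:R) & lap a X = Pminus k X.
Proof.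
have [q [qq _ qX]] := eigen_basis Xs.
case/andP: kN => k0 kleN.
exists (fun l => q (widen_ord kleN l)).
  by move=> l m; rewrite qq; congr (_ %:R).
apply: eq_bigr => l _; rewrite qX (bigD1 (widen_ord kleN l))//= qq eqxx.
rewrite expr1n mulr1 big1 ?addr0// => i il.
by rewrite qq eq_sym (negbTE il) expr0n mulr0.
Qed.

End KyFan.

(** * Sup-convolution and doubling of variables *)

(** The superlevel sets at attained values are nested and generate a proper filter on [K];
    semicontinuity at a cluster point bounds every value by the one there. *)
Lemma usc_max (R : realType) (T : topologicalType) (K : set T) (u : T -> R) :
  compact K -> K !=set0 ->
  (forall x, K x -> forall e, 0 < e ->
    exists2 V, nbhs x V & forall y, K y -> V y -> u y < u x + e) ->
  exists2 x, K x & forall y, K y -> u y <= u x.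
Proof.
move=> cK [k0 Kk0] usc.
pose A x := [set y | K y /\ u x <= u y].
pose F : set_system T := [set S | exists2 x, K x & A x `<=` S].
have FF : ProperFilter F.
  split; first by move=> [x Kx /(_ x)]; apply; split.
  split.
  - by exists k0.
  - move=> P Q [x Kx xP] [y Ky yQ]; have [xy|yx] := leP (u x) (u y).
      exists y => // z [Kz yz]; split; last exact: yQ.
      by apply: xP; split=> //; exact: le_trans yz.
    exists x => // z [Kz xz]; split; first exact: xP.
    by apply: yQ; split=> //; apply: le_trans xz; exact: ltW.
  - by move=> P Q PQ [x Kx xP]; exists x => //; exact: subset_trans PQ.
have FK : F K by exists k0 => // y [].
have [p [Kp clp]] := cK F FF FK.
exists p => // y Ky; apply/ler_addgt0Pr => e e0.
have [V pV Ve] := usc p Kp e e0.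
have FA : F (A y) by exists y.
have [q [[Kq yq] Vq]] := clp _ _ FA pV.
exact: le_trans yq (ltW (Ve q Kq Vq)).
Qed.

Lemma compact_norm_le (R : realType) (N : nat) (K : set 'rV[R]_N) : compact K ->
  exists2 B, 0 <= B & forall x, K x -> `|x| <= B.
Proof.
move=> cK; have [M [_ MB]] := compact_bounded cK.
exists (Num.max M 0 + 1); first by rewrite addr_ge0// le_max lexx orbT.
by move=> x Kx; apply: MB => //; rewrite ltr_pwDr// le_max lexx.
Qed.

Section MaxConv.
Variables (R : realType) (N : nat) (K : set 'rV[R]_N) (al : R).
Implicit Types (u F G : 'rV[R]_N -> R) (x y z : 'rV[R]_N).

(* Semicontinuity relative to [K], in a form whose hypotheses do not involve the
   subspace topology. *)
Definition usc_in u := forall x, K x -> forall e, 0 < e ->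
  exists2 V, nbhs x V & forall y, K y -> V y -> u y < u x + e.

(** Equals u(x) - (al/2)|x - y|^2 + (al/2)|y|^2. Its supremum over x is the sup-convolution made
    convex, a supremum of affine functions of y. *)
Definition pairing u x y := u x - al / 2 * sqn x + al * dot x y.

Definition maxconv u F :=
  (forall x y, K x -> pairing u x y <= F y) /\
  (forall y, exists2 x, K x & pairing u x y = F y).

Lemma usc_in_cont u F : usc_in u -> continuous F -> usc_in (fun x => u x + F x).
Proof.
move=> uu Fc x Kx e e0.
have e20 : 0 < e / 2 by rewrite divr_gt0.
have [V xV Vu] := uu x Kx _ e20.
have key : \forall y \near x, `|F x - F y| < e / 2.
  by have /cvgrPdist_lt/(_ _ e20) := Fc x; exact.
exists (V `&` [set y | `|F x - F y| < e / 2]); first exact: filterI.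
move=> y Ky [/(Vu _ Ky) h /=]; rewrite ltr_norml; lra.
Qed.

Lemma maxconv_exists u : compact K -> K !=set0 -> usc_in u -> exists F, maxconv u F.
Proof.
move=> cK K0 uu.
have H y : exists x, K x /\ forall x', K x' -> pairing u x' y <= pairing u x y.
  suff pu : usc_in (pairing u ^~ y) by have [x Kx xm] := usc_max cK K0 pu; exists x.
  rewrite /pairing.
  have -> : (fun x => u x - al / 2 * sqn x + al * dot x y) =
      (fun x => u x + (- (al / 2) * sqn x + (dot (al *: y) x + 0))).
    by apply/funext => x; rewrite dotZl (dotC y); ring.
  apply: usc_in_cont => //.
  exact: (jet_cont (jetD (jetZ (- (al / 2)) (jet_sqn R N)) (jet_affine (al *: y) 0))).
have [f fP] := choice H.
exists (fun y => pairing u (f y) y); split; first by move=> x y Kx; apply: (fP y).2.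
by move=> y; exists (f y) => //; exact: (fP y).1.
Qed.

Variables (u F : 'rV[R]_N -> R).
Hypothesis uF : maxconv u F.

(** The subgradient is [al *: x]; recording [x] keeps the maximizer itself. *)
Definition subgrad F x y := forall y', F y + al * dot x (y' - y) <= F y'.

Lemma maxconv_subgrad x y : K x -> pairing u x y = F y -> subgrad F x y.
Proof.
move=> Kx xy y'; apply: le_trans (uF.1 x y' Kx).
rewrite -xy /pairing dotDr dotNr; lra.
Qed.

Lemma maxconv_midconvex : midconvex F.
Proof.
move=> x h; have [p Kp pE] := uF.2 x.
have := uF.1 p (x + h) Kp; have := uF.1 p (x - h) Kp.
rewrite -pE /pairing !dotDr dotNr; lra.
Qed.

Lemma maxconv_lip : compact K -> is_lip F.
Proof.
move=> cK; have [B B0 KB] := compact_norm_le cK.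
exists (`|al| * (N%:R * B)); first by rewrite !mulr_ge0.
have H x y : F x <= F y + `|al| * (N%:R * B) * `|x - y|.
  have [p Kp pE] := uF.2 x.
  have := maxconv_subgrad Kp pE y.
  suff : `|al * dot p (y - x)| <= `|al| * (N%:R * B) * `|x - y|.
    rewrite ler_norml; lra.
  rewrite normrM -mulrA ler_wpM2l//; apply: le_trans (dot_le _ _) _.
  by rewrite distrC ler_wpM2r// ler_wpM2l// KB.
move=> x y; have := H x y; have := H y x.
by rewrite (distrC y x) ler_norml; lra.
Qed.

End MaxConv.

Section Touch.
Variables (R : realType) (N : nat) (al : R).
Implicit Types (u F G phi : 'rV[R]_N -> R) (x y z : 'rV[R]_N).

(** Near [y] the function lies between an affine function and a jet, with equality at [y]. If a
    partial derivative differed, a short move against the difference [A] would reverse the order. *)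
Lemma touch_grad K phi g X F x y : jet K phi g X -> phi y = F y ->
  (\forall y' \near y, F y' <= phi y') -> subgrad al F x y -> g y = al *: x.
Proof.
move=> J Fy nF sF; apply/rowP => i; rewrite mxE; apply/eqP.
have /nbhs_ballP[d d0' dF] := nF.
have d0 : 0 < d := d0'.
rewrite -subr_eq0; set A := _ - _; apply/negP => /negP A0.
have K0 := jet_K J.
have nA : 0 < `|A| by rewrite normr_gt0.
(* The first bound keeps the quadratic remainder below the first-order gain, the second keeps the
   move inside the ball of radius [d]. *)
pose s := Num.min ((K + 1)^-1) (d / 2 / `|A|).
have K1 : 0 < K + 1 by lra.
have s0 : 0 < s by rewrite lt_min invr_gt0 K1 /= !divr_gt0.
have sK : s * (K + 1) <= 1.
  by rewrite -ler_pdivlMr// div1r ge_min lexx.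
have sd : s * `|A| <= d / 2 by rewrite -ler_pdivlMr// ge_min lexx orbT.
pose t := - (s * A).
have [q _] := jet_grad J i.
have := q y t; rewrite Fy.
have : F (y + t *: delta_mx 0 i) <= phi (y + t *: delta_mx 0 i).
  apply: dF; rewrite -ball_normE /= opprD addrA subrr add0r normrN normrZ.
  apply: (@le_lt_trans _ _ `|t|); first by rewrite ler_piMr// norm_delta_le.
  rewrite /t normrN normrM (gtr0_norm s0); lra.
have := sF (y + t *: delta_mx 0 i).
rewrite (_ : y + t *: _ - y = t *: delta_mx 0 i); last by rewrite addrAC subrr add0r.
rewrite dotZr dot_delta ler_norml => h1 h2 /andP[_ h3].
have h4 : - (t * A) <= K * t ^+ 2 by rewrite /A; lra.
rewrite /t in h4.
have A2 : 0 < A ^+ 2 by rewrite exprn_even_gt0.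
have h5 : s * A ^+ 2 <= s * A ^+ 2 * (s * K) by move: h4; lra.
have sA : 0 < s * A ^+ 2 by rewrite mulr_gt0.
have : 1 <= s * K by rewrite -(ler_pM2l sA) mulr1.
lra.
Qed.

(** A test function for the transform, translated by the fixed vector x - y, becomes one for [u] at
    the maximizer: insert the pair x', x' - (x - y) in the inequality defining [F]. The quadratic
    part of [pairing] shifts the Hessian by [- al]. *)
Lemma touch_transfer (K : set 'rV[R]_N) u F c phi g X x y : maxconv K al u F ->
  nbhs x K -> pairing al u x y = F y -> jet c phi g X -> phi y = F y ->
  (\forall y' \near y, F y' <= phi y') ->
  exists c' T gT XT, [/\ jet c' T gT XT, T x = u x, (\forall x' \near x, u x' <= T x'),
    gT x = al *: (x - y) & XT x = X y + (- al)%:M].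
Proof.
move=> uF xK xy J Fy nF.
have Kx : K x := nbhs_singleton xK.
have gy := touch_grad J Fy nF (maxconv_subgrad uF Kx xy).
pose e := x - y.
have JJ := jetD (jetD (jet_shift (- e) J) (jetZ (- (al / 2)) (jet_sqn R N)))
  (jet_affine (al *: e) 0).
have xe : x - e = y by rewrite /e subKr.
do 4!eexists; split; first exact: JJ.
- rewrite /= xe Fy -xy /pairing /e dotZl dotDl dotNl (dotC y) -/(sqn x); lra.
- have nF' : \forall x' \near x, F (x' - e) <= phi (x' - e).
    have /nbhs_ballP[d d0 dF] := nF; apply: filterS (near_norm x d0) => x' xx'.
    have E : y - (x' - e) = - (x' - x) by rewrite /e !opprB addrCA subrKA.
    by apply: dF; rewrite -ball_normE /= E normrN.
  apply: filterS2 xK nF' => x' Kx' h.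
  have := uF.1 x' (x' - e) Kx'.
  rewrite /pairing dotDr dotNr dotZl (dotC e) -/(sqn x'); lra.
- rewrite /= xe gy scalerA mulNr divfK ?pnatr_eq0// /e; rewrite scaleNr subrr add0r//.
- rewrite /= xe addr0; congr (_ + _); apply/matrixP => i j; rewrite !mxE.
  by rewrite mulrnAr mulNr divfK ?pnatr_eq0.
Qed.

(* At the maximum point [y0] of [F + G - al |y|^2] the subgradient of [F] is unique;
   testing with [y + (x - x0) / 2] makes this quantitative. *)
Lemma subgrad_close F G m x0 z0 y0 x y : 0 < al ->
  (forall y, F y + G y <= m + al * sqn y) -> F y0 + G y0 = m + al * sqn y0 ->
  x0 + z0 = 2 *: y0 -> subgrad al F x0 y0 -> subgrad al G z0 y0 ->
  subgrad al F x y -> sqn (x - x0) <= 24 * sqn (y - y0).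
Proof.
move=> al0 FG FG0 xz sF sG sx.
pose h := y - y0; pose d := x - x0.
pose y1 := y + 2^-1 *: d.
have e1 := sx y1; have e2 := sF y; have e3 := sG y1; have e4 := FG y1.
have y1y : y1 - y = 2^-1 *: d by rewrite /y1 addrAC subrr add0r.
have y1y0 : y1 - y0 = h + 2^-1 *: d by rewrite /y1 addrAC.
have y1E : y1 = y0 + (h + 2^-1 *: d) by rewrite -y1y0 addrC subrK.
rewrite y1y in e1; rewrite y1y0 in e3; rewrite -/h in e2 *; rewrite -/d.
have zE : z0 = 2 *: y0 - x0 by rewrite -xz addrAC subrr add0r.
have xE : x = x0 + d by rewrite /d addrC subrK.
rewrite zE in e3; rewrite xE in e1; rewrite y1E in e4.
clearbody y1 h d.
have key : al * (sqn h + dot h d + sqn d / 4 - sqn d / 2) >= 0.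
  move: e1 e2 e3 e4; rewrite -y1E.
  have -> : sqn y1 = sqn y0 + 2 * dot y0 h + dot y0 d + sqn h + dot h d + sqn d / 4.
    by rewrite y1E !sqnD sqnZ !dotDr !dotZr; field.
  rewrite !(dotDl, dotDr, dotNl, dotZl, dotZr) -/(sqn d); lra.
rewrite pmulr_rge0// in key.
(* Young's inequality <h, d> <= |d|^2 / 8 + 2 |h|^2, inserted into [key], gives the factor 24. *)
have := sqn_ge0 (d - 4 *: h).
rewrite sqnD sqnN sqnZ dotNr dotZr (dotC d); lra.
Qed.

End Touch.

(** If no [al] worked, bad pairs would exist for every [al] and, u - v being bounded above, would
    cluster at a diagonal point. Semicontinuity makes u - v nonnegative there, where the local
    hypothesis applies. *)
Lemma penalization (R : realType) (N : nat) (K : set 'rV[R]_N)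
    (u v : 'rV[R]_N -> R) (W : set ('rV[R]_N * 'rV[R]_N)) :
  compact K -> usc_in K u -> usc_in K (fun x => - v x) ->
  (forall x, K x -> 0 <= u x - v x -> exists2 V, nbhs (x, x) V &
     forall p, K p.1 -> K p.2 -> V p -> W p) ->
  exists2 al, 0 < al & forall p, K p.1 -> K p.2 ->
    0 <= u p.1 - v p.2 - al * sqn (p.1 - p.2) -> W p.
Proof.
move=> cK uu vv contactW.
have [[k0 Kk0]|K0] := pselect (K !=set0); last first.
  by exists 1 => // p K1; exfalso; apply: K0; exists p.1.
have uscuv : forall p, (K `*` K) p -> forall e, 0 < e ->
    exists2 V, nbhs p V & forall q, (K `*` K) q -> V q ->
      u q.1 - v q.2 < u p.1 - v p.2 + e.
  move=> [x z] [/= Kx Kz] e e0; have e20 : 0 < e / 2 by rewrite divr_gt0.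
  have [V1 xV1 h1] := uu x Kx _ e20; have [V2 zV2 h2] := vv z Kz _ e20.
  exists (V1 `*` V2); first by exists (V1, V2).
  move=> [x' z'] [/= Kx' Kz'] [/= /(h1 _ Kx') ? /(h2 _ Kz')]; lra.
have cKK := compact_setX cK cK.
have [[x1 z1] [/= Kx1 Kz1] M] := usc_max cKK (ex_intro _ (k0, k0) (conj Kk0 Kk0)) uscuv.
set m := u x1 - v z1 in M.
apply: contrapT => nal.
pose B (al : R) := [set p | [/\ K p.1, K p.2,
  0 <= u p.1 - v p.2 - al * sqn (p.1 - p.2) & ~ W p]].
have B0 al : 0 < al -> B al !=set0.
  move=> al0; apply: contrapT => Be; apply: nal; exists al => // p K1 K2 h.
  by apply: contrapT => nW; apply: Be; exists p.
pose F : set_system ('rV[R]_N * 'rV[R]_N) := [set S | exists2 al, 0 < al & B al `<=` S].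
have FF : ProperFilter F.
  split.
    by move=> [al al0 /=]; have [p Bp] := B0 al al0; apply: (_ : ~ _) => h; exact: (h p).
  split.
  - by exists 1.
  - move=> P Q [a a0 aP] [b b0 bQ]; exists (a + b); first exact: addr_gt0.
    move=> p [K1 K2 h nW]; have := sqn_ge0 (p.1 - p.2) => s0.
    have ha := mulr_ge0 (ltW a0) s0; have hb := mulr_ge0 (ltW b0) s0.
    by split; [apply: aP; split => //; lra|apply: bQ; split => //; lra].
  - by move=> P Q PQ [a a0 aP]; exists a => //; exact: subset_trans PQ.
have FK : F (K `*` K) by exists 1 => // p [].
have [[x z] [[/= Kx Kz] clp]] := cKK F FF FK.
have FB al : 0 < al -> F (B al) by exists al.
have uvz : 0 <= u x - v z.
  apply/ler_addgt0Pr => e e0.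
  have [V pV Ve] := uscuv (x, z) (conj Kx Kz) e e0.
  have [p [[K1 K2 h _] Vp]] := clp _ _ (FB 1 ltr01) pV.
  have := Ve p (conj K1 K2) Vp; have := sqn_ge0 (p.1 - p.2) => /=; lra.
have xz : x = z.
  apply/eqP; rewrite -subr_eq0 -normr_eq0 eq_le normr_ge0 andbT.
  apply/ler_addgt0Pr => e e0; rewrite add0r.
  have e30 : 0 < e / 3 by rewrite divr_gt0.
  pose V := [set p : 'rV[R]_N * 'rV[R]_N | `|p.1 - x| < e / 3 /\ `|p.2 - z| < e / 3].
  have xV : nbhs (x, z) V.
    exists ([set p | `|p - x| < e / 3], [set p | `|p - z| < e / 3]) => /=.
      by split; [exact: (near_norm x e30)|exact: (near_norm z e30)].
    by move=> [? ?] [].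
  pose al := (`|m| + 1) / (e / 3) ^+ 2.
  have al0 : 0 < al by rewrite divr_gt0 ?exprn_gt0//; have := normr_ge0 m; lra.
  have [[p q] [[/= K1 K2 h _] [/= px qz]]] := clp _ _ (FB _ al0) xV.
  have pq : `|p - q| < e / 3.
    rewrite ltNge; apply/negP => epq.
    have h1 : (e / 3) ^+ 2 <= sqn (p - q).
      by apply: le_trans (norm_sqn _); rewrite lerXn2r ?nnegrE// ltW.
    have h2 : `|m| + 1 <= al * sqn (p - q).
      apply: le_trans (ler_wpM2l (ltW al0) h1).
      by rewrite /al divfK// gt_eqF// exprn_gt0.
    have := M (p, q) (conj K1 K2); rewrite /=; have := ler_norm m; lra.
  rewrite -(subrKA p) (le_trans (ler_normD _ _))//.
  rewrite (distrC x); have := ler_distD q p z; lra.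
have [V pV VW] := contactW x Kx ltac:(by rewrite -xz in uvz).
rewrite -xz in clp.
have [p [[K1 K2 _ nW] Vp]] := clp _ _ (FB 1 ltr01) pV.
exact: nW (VW p K1 K2 Vp).
Qed.

(* [s = 1] for the subsolution and [s = -1] for the supersolution, to which
   [maxconv] is applied with [- v]. *)
Lemma maxconv_local (R : realType) (N : nat) (K : set 'rV[R]_N) (u F : 'rV[R]_N -> R)
    (H : 'rV[R]_N -> 'rV[R]_N -> R) (al s e : R) (x0 y0 : 'rV[R]_N) :
  0 < al -> `|s| = 1 -> 0 < e -> maxconv K al u F -> continuous F -> nbhs x0 K ->
  pairing al u x0 y0 = F y0 ->
  (forall x y, subgrad al F x y -> sqn (x - x0) <= 24 * sqn (y - y0)) ->
  (forall p, exists2 d, 0 < d & forall x q, `|x - x0| < d -> `|q - p| < d ->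
     `|H x q - H x0 p| < e) ->
  exists2 r, 0 < r & forall x y, K x -> pairing al u x y = F y -> `|y - y0| < r ->
    [/\ nbhs x K, `|u x - u x0| <= e
     & `|H x (s *: (al *: (x - y))) - H x0 (s *: (al *: (x0 - y0)))| <= e].
Proof.
move=> al0 s1 e0 uF Fc x0K xy0 close Hc.
have Kx0 := nbhs_singleton x0K.
(* Although [u] is only semicontinuous, at a maximizer it is a continuous function of y and x - y,
   so it varies little along maximizers. *)
pose A y := F y + (- (al / 2)) * sqn y.
have Ac : continuous A.
  move=> y; apply: (@continuousD R R^o _ F (fun y => - (al / 2) * sqn y)).
    exact: Fc.
  exact: (jet_cont (jetZ (- (al / 2)) (jet_sqn R N))).
have uE x y : pairing al u x y = F y -> u x = A y + al / 2 * sqn (x - y).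
  by rewrite /A => <-; rewrite /pairing sqnD sqnN dotNr; field.
have e20 : 0 < e / 2 by rewrite divr_gt0.
have [d1 d10 Ad] : exists2 d, 0 < d & forall y, `|y - y0| < d -> `|A y - A y0| < e / 2.
  have /cvgrPdist_lt/(_ _ e20)/nbhs_ballP[d d0 dA] := Ac y0.
  exists d => // y yd; rewrite distrC; apply: dA.
  by rewrite -ball_normE /= distrC.
pose w := x0 - y0.
have [d2 d20 Sd] : exists2 d, 0 < d &
    forall z, `|z - w| < d -> `|al / 2 * sqn z - al / 2 * sqn w| < e / 2.
  have Sc : continuous (fun z : 'rV[R]_N => al / 2 * sqn z).
    exact: (jet_cont (jetZ (al / 2) (jet_sqn R N))).
  have /cvgrPdist_lt/(_ _ e20)/nbhs_ballP[d d0 dA] := Sc w.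
  exists d => // y yd; rewrite distrC; apply: dA.
  by rewrite -ball_normE /= distrC.
have [d3 d30 Kd] : exists2 d, 0 < d & forall x, `|x - x0| < d -> nbhs x K.
  have /nbhs_interior/nbhs_ballP[d d0 dA] := x0K.
  exists d => // x xd; apply: dA.
  by rewrite -ball_normE /= distrC.
have [d4 d40 Hd] := Hc (s *: (al *: (x0 - y0))).
pose D := Num.min (Num.min d1 d2) (Num.min d3 d4).
have D0 : 0 < D by rewrite !lt_min d10 d20 d30 d40.
have [D1 D2 D3 D4] : [/\ D <= d1, D <= d2, D <= d3 & D <= d4].
  by rewrite !ge_min !lexx !orbT.
(* The bound |x - x0|^2 <= 24 |y - y0|^2 is Euclidean; passing to the sup norm costs the factor [N],
   and 24 N <= C^2. *)
pose C : R := 24 * N%:R + 1.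
have C1 : 1 <= C by rewrite /C lerDr.
pose r := D / ((C + 1) * (al + 1)).
have q0 : 0 < (C + 1) * (al + 1) by rewrite mulr_gt0//; lra.
have rE : (C + 1) * (al + 1) * r = D by rewrite /r mulrC divfK// gt_eqF.
exists r; first by rewrite divr_gt0.
move=> x y Kx xy yr.
pose h := `|y - y0|; have h0 : 0 <= h by exact: normr_ge0.
have xh : `|x - x0| <= C * h.
  have c := close x y (maxconv_subgrad uF Kx xy).
  have n1 := norm_sqn (x - x0).
  have n2 : sqn (y - y0) <= N%:R * h * h by apply: le_trans (ler_norm _) (dot_le _ _).
  have N0 : 0 <= N%:R :> R by [].
  rewrite -(@ler_pXn2r _ 2) ?nnegrE// ?mulr_ge0//; last by lra.
  have hh : 0 <= N%:R * (h * h) by rewrite !mulr_ge0.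
  have hh2 : 0 <= h * h by rewrite mulr_ge0.
  have NN : 0 <= N%:R * N%:R * (h * h) by rewrite !mulr_ge0.
  have -> : (C * h) ^+ 2 = 576 * (N%:R * N%:R * (h * h)) + 48 * (N%:R * (h * h)) + h * h.
    by rewrite /C; ring.
  lra.
have hr : (C + 1) * h * (al + 1) < D.
  by rewrite -rE mulrAC ltr_pM2l.
have ah0 : 0 <= (C + 1) * h * al by rewrite !mulr_ge0//; lra.
have Ch0 : 0 <= (C + 1) * h by rewrite !mulr_ge0//; lra.
have Ch1 : 0 <= C * h by rewrite !mulr_ge0//; lra.
have zE : x - y - w = (x - x0) - (y - y0).
  by rewrite /w !opprB [LHS]addrACA [RHS]addrACA (addrC (- y)).
have zw : `|x - y - w| <= (C + 1) * h.
  rewrite zE (le_trans (ler_normB _ _))// mulrDl mul1r lerD//.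
split.
- by apply: Kd; lra.
- rewrite (uE _ _ xy) (uE _ _ xy0) -/w.
  have := Ad y ltac:(rewrite -/h; lra); have := Sd (x - y) ltac:(lra).
  rewrite !ltr_norml ler_norml; lra.
- apply/ltW/Hd; first lra.
  rewrite -scalerBr normrZ s1 mul1r -scalerBr normrZ (gtr0_norm al0) -/w.
  have : al * `|x - y - w| <= al * ((C + 1) * h) by rewrite ler_wpM2l// ltW.
  lra.
Qed.

Lemma within_openX_continuous (R : realType) (N : nat) (Omega : set 'rV[R]_N)
    (H : 'rV[R]_N -> 'rV[R]_N -> R) (x0 p : 'rV[R]_N) (e : R) :
  open Omega ->
  {within Omega `*` setT, continuous (fun z : 'rV[R]_N * 'rV[R]_N => H z.1 z.2)} ->
  Omega x0 -> 0 < e ->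
  exists2 d, 0 < d & forall x q, `|x - x0| < d -> `|q - p| < d -> `|H x q - H x0 p| < e.
Proof.
move=> oO Hc Ox0 e0.
have nO : nbhs (x0, p) (Omega `*` setT).
  exists (Omega, setT) => //; split; last exact: filterT.
  exact: open_nbhs_nbhs.
have Hc' : (fun z : 'rV[R]_N * 'rV[R]_N => H z.1 z.2) z @[z --> (x0, p)] --> H x0 p.
  have := Hc (x0, p); rewrite /continuous_at /=.
  by rewrite -nbhs_subspace_interior.
have /cvgrPdist_lt/(_ _ e0)/nbhs_ballP[d d0 dH] := Hc'.
exists d => // x q xd qd; rewrite distrC; apply: (dH (x, q)).
by split; rewrite -ball_normE /= distrC.
Qed.

Lemma enorm_sqn (R : realType) (N : nat) (x : 'rV[R]_N) : enorm x ^+ 2 = sqn x.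
Proof.
have E : enorm x = Num.sqrt (sqn x).
  by congr Num.sqrt; apply: eq_bigr => i _; rewrite expr2.
by rewrite E sqr_sqrtr// sqn_ge0.
Qed.

Lemma enorm_ge0 (R : realType) (N : nat) (x : 'rV[R]_N) : 0 <= enorm x.
Proof. exact: sqrtr_ge0. Qed.

Lemma enormZ (R : realType) (N : nat) (c : R) (x : 'rV[R]_N) :
  enorm (c *: x) = `|c| * enorm x.
Proof.
apply/eqP; rewrite -(@eqrXn2 _ 2) ?enorm_ge0 ?mulr_ge0 ?enorm_ge0//.
by rewrite exprMn !enorm_sqn sqnZ real_normK ?num_real.
Qed.

(** * Solutions tested with jets *)

Section JetSolutions.
Variables (R : realType) (N : nat) (F : operator R N) (Omega : set 'rV[R]_N).

Definition jet_subsolution (u : 'rV[R]_N -> R) :=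
  forall x C phi g X, Omega x -> jet C phi g X -> touches_above phi u x ->
  0 <= F x (u x) (g x) (X x).

Definition jet_supersolution (u : 'rV[R]_N -> R) :=
  forall x C phi g X, Omega x -> jet C phi g X -> touches_below phi u x ->
  F x (u x) (g x) (X x) <= 0.

Lemma subsolution_jet u : subsolution F Omega u -> jet_subsolution u.
Proof.
move=> [_ us] x C phi g X Ox J t; have [C2 <- <-] := jet_C2 J.
exact: (us x setT phi Ox openT I C2 t).
Qed.

Lemma supersolution_jet u : supersolution F Omega u -> jet_supersolution u.
Proof.
move=> [_ us] x C phi g X Ox J t; have [C2 <- <-] := jet_C2 J.
exact: (us x setT phi Ox openT I C2 t).
Qed.

End JetSolutions.

(** * The inequality at a maximum of the doubled function *)

Section Comparison.
Variables (R : realType) (N k : nat) (Omega : set 'rV[R]_N)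
    (H : 'rV[R]_N -> 'rV[R]_N -> R).
Hypothesis kN : (0 < k <= N)%N.
Hypothesis Omega_open : open Omega.
Hypothesis H_cont : {within Omega `*` setT,
                 continuous (fun z : 'rV[R]_N * 'rV[R]_N => H z.1 z.2)}.

Let k_gt0 : (0 < k)%N. Proof. by case/andP: kN. Qed.
Let k0 : 0 < k%:R :> R. Proof. by rewrite ltr0n. Qed.

Section Doubled.
Variables (u v : 'rV[R]_N -> R) (mu1 mu2 : R) (K : set 'rV[R]_N).
Hypothesis u_sub : jet_subsolution (Emu k H mu1) Omega u.
Hypothesis v_super : jet_supersolution (Emu k H mu2) Omega v.
Hypothesis K_compact : compact K.
Hypothesis KO : K `<=` Omega.
Hypothesis u_usc : usc_in K u.
Hypothesis v_lsc : usc_in K (fun x => - v x).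

(* Replaces the theorem on sums: [X <= Y] is used only through
   [Pminus k X <= Pminus k Y], which has been eliminated here. *)
Lemma doubled_ineq (al e : R) (x0 z0 : 'rV[R]_N) : 0 < al -> 0 < e ->
  nbhs x0 K -> nbhs z0 K ->
  (forall x z, K x -> K z -> u x - v z - al / 4 * sqn (x - z) <=
     u x0 - v z0 - al / 4 * sqn (x0 - z0)) ->
  H z0 ((al / 2) *: (x0 - z0)) - H x0 ((al / 2) *: (x0 - z0)) +
  mu2 * v z0 - mu1 * u x0 <= e.
Proof.
move=> al0 e0 x0K z0K xzmax.
have Kx0 := nbhs_singleton x0K; have Kz0 := nbhs_singleton z0K.
have K0 : K !=set0 by exists x0.
have [F uF] := maxconv_exists al K_compact K0 u_usc.
have [G vG] := maxconv_exists al K_compact K0 v_lsc.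
have FL := maxconv_lip uF K_compact; have [L L0 FL'] := FL.
have [M M0 GM] := maxconv_lip vG K_compact.
have Fc := lip_continuous L0 FL'; have Gc := lip_continuous M0 GM.
have Fm := maxconv_midconvex uF.
set m := u x0 - _ - _ in xzmax.
pose y0 := 2^-1 *: (x0 + z0).
have xzy : x0 + z0 = 2 *: y0 by rewrite /y0 scalerA divff ?scale1r// pnatr_eq0.
(* Completing the square at the midpoint of x and z separates the doubled function from the variable
   y. *)
have pairE x z y : pairing al u x y + pairing al (fun x => - v x) z y =
    u x - v z - al / 4 * sqn (x - z) - al * sqn (y - 2^-1 *: (x + z)) + al * sqn y.
  rewrite /pairing !sqnD !sqnN !dotNr !dotZr sqnZ sqnD !dotDr (dotC y x) (dotC y z).
  by field.
have FGle y : F y + G y <= m + al * sqn y.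
  have [x Kx <-] := uF.2 y; have [z Kz <-] := vG.2 y; rewrite pairE.
  have := xzmax x z Kx Kz.
  have := mulr_ge0 (ltW al0) (sqn_ge0 (y - 2^-1 *: (x + z))); lra.
have pE0 : pairing al u x0 y0 + pairing al (fun x => - v x) z0 y0 = m + al * sqn y0.
  by rewrite pairE -/y0 subrr sqn0 /m; ring.
have px0 : pairing al u x0 y0 = F y0.
  have := FGle y0; have := uF.1 x0 y0 Kx0; have := vG.1 z0 y0 Kz0; lra.
have pz0 : pairing al (fun x => - v x) z0 y0 = G y0.
  have := FGle y0; have := uF.1 x0 y0 Kx0; have := vG.1 z0 y0 Kz0; lra.
have FG0 : F y0 + G y0 = m + al * sqn y0 by rewrite -px0 -pz0.
have sF := maxconv_subgrad uF Kx0 px0.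
have sG := maxconv_subgrad vG Kz0 pz0.
have closeF x y := subgrad_close al0 FGle FG0 xzy sF sG (x := x) (y := y).
have closeG x y : subgrad al G x y -> sqn (x - z0) <= 24 * sqn (y - y0).
  have GF y' : G y' + F y' <= m + al * sqn y' by rewrite addrC.
  apply: (subgrad_close al0 GF _ _ sG sF); first by rewrite addrC.
  by rewrite addrC.
have x0y0 : x0 - y0 = 2^-1 *: (x0 - z0).
  by apply/rowP => j; rewrite !mxE; field.
have z0y0 : z0 - y0 = - (2^-1 *: (x0 - z0)).
  by apply/rowP => j; rewrite !mxE; field.
set p := (al / 2) *: (x0 - z0).
have px : 1 *: (al *: (x0 - y0)) = p by rewrite scale1r x0y0 scalerA.
have pz : -1 *: (al *: (z0 - y0)) = p by rewrite z0y0 scaleN1r scalerN opprK scalerA.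
pose q := 1 + `|mu1| + `|mu2|.
have q1 : 1 <= q by rewrite /q; have := normr_ge0 mu1; have := normr_ge0 mu2; lra.
pose e1 := e / (8 * q).
have e10 : 0 < e1 by rewrite divr_gt0// mulr_gt0//; lra.
have e1q : e1 * q = e / 8 by rewrite /e1; field; lra.
have e1e : e1 <= e / 8 by rewrite -e1q ler_peMr// ltW.
have e1m mu (s t : R) : `|mu| <= q -> `|s - t| <= e1 -> `|mu * s - mu * t| <= e / 8.
  move=> muq st; rewrite -mulrBr normrM -e1q mulrC.
  by rewrite ler_pM.
have m1q : `|mu1| <= q by rewrite /q; have := normr_ge0 mu2; lra.
have m2q : `|mu2| <= q by rewrite /q; have := normr_ge0 mu1; lra.
have s1 : `|1 : R| = 1 by rewrite normr1.
have sN1 : `|-1 : R| = 1 by rewrite normrN normr1.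
have HcF p' := within_openX_continuous p' Omega_open H_cont (KO Kx0) e10.
have HcG p' := within_openX_continuous p' Omega_open H_cont (KO Kz0) e10.
have [r1 r10 locF] := maxconv_local al0 s1 e10 uF Fc x0K px0 closeF HcF.
have [r2 r20 locG] := maxconv_local al0 sN1 e10 vG Gc z0K pz0 closeG HcG.
rewrite px in locF; rewrite pz in locG.
(* The term [k%:R * al] compensates the Hessian shift in the transfer to [u]; [e / 4] covers the
   errors in [H] and in [mu1 * u]. Nothing here depends on the frame. *)
pose c := k%:R * al - H x0 p - mu1 * u x0 - e / 4.
have F_visc (a : 'I_k -> 'rV[R]_N) : (forall l n, dot (a l) (a n) = (l == n)%:R) ->
    forall y phi g X C, `|y - y0| < 2 * (r1 / 2) -> jet C phi g X ->
    phi y = F y -> (\forall y' \near y, F y' <= phi y') -> c <= lap a (X y).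
  move=> aa y phi g X C yr J Fy nF.
  have [x Kx xy] := uF.2 y.
  have [xK ux Hx] := locF x y Kx xy ltac:(lra).
  have [c' [T [gT [XT [JT Tx nT gTE XTE]]]]] := touch_transfer uF xK xy J Fy nF.
  have := u_sub (KO Kx) JT (conj Tx nT).
  rewrite /Emu gTE.
  have := Pminus_le_lap (jet_sym JT x) kN aa.
  rewrite XTE lapD lap_scalar; last by move=> l; rewrite /sqn aa eqxx.
  have := e1m _ _ _ m1q ux.
  move: Hx; rewrite scale1r !ler_norml /c; lra.
have r20' : 0 < r2 / 2 by rewrite divr_gt0.
have r10' : 0 < r1 / 2 by rewrite divr_gt0.
pose rho := Num.min (r1 / 4) (r2 / 2).
have rho0 : 0 < rho by rewrite lt_min !divr_gt0.
have [rho1 rho2] : rho <= r1 / 4 /\ rho <= r2 / 2 by rewrite !ge_min !lexx orbT.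
(* The term sg |y - y0|^2 makes the maximum strict and changes the trace by 2 k sg = e / 8. As [MF]
   is within [ep] of [F], a maximum at distance [rho] would need sg rho^2 <= 2 ep, which the quarter
   in [ep] excludes. *)
pose sg := e / (16 * k%:R).
have sg0 : 0 < sg by rewrite divr_gt0// mulr_gt0.
have ksg : k%:R * sg = e / 16 by rewrite /sg; field; rewrite gt_eqF.
pose ep := sg * rho ^+ 2 / 4.
have ep0 : 0 < ep by rewrite divr_gt0// mulr_gt0// exprn_gt0.
pose d := Num.min (ep / (2 * N%:R * L + 1)) (r1 / 8 / (2 * N%:R + 1)).
have NL : 0 < 2 * N%:R * L + 1 by rewrite ltr_wpDl// !mulr_ge0.
have N1 : 0 < 2 * N%:R + 1 :> R by rewrite ltr_wpDl// !mulr_ge0.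
have d0 : 0 < d.
  rewrite lt_min (divr_gt0 ep0 NL) /=; apply: divr_gt0 => //; exact: divr_gt0.
have Ld : L * (2 * N%:R * d) <= ep.
  have : d * (2 * N%:R * L + 1) <= ep by rewrite -ler_pdivlMr// ge_min lexx.
  lra.
have Nd : 2 * N%:R * d <= r1 / 8.
  have : d * (2 * N%:R + 1) <= r1 / 8 by rewrite -ler_pdivlMr// ge_min lexx orbT.
  lra.
have [C [g [X J]]] := jet_moll d0 L0 FL'.
set MF := moll (axes N d) F in J.
have MFd y : `|MF y - F y| <= ep.
  apply: le_trans (moll_dist _ y L0 FL') _; apply: le_trans Ld.
  by apply: ler_wpM2l => //; apply: axes_norm; exact: ltW.
have Jq := jetD (jetZ (-1) J) (jetD (jetZ al (jet_sqn R N))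
   (jetZ sg (jet_shift (- y0) (jet_sqn R N)))).
set psi := (fun x => _ + _) in Jq.
have thc : continuous (fun y => G y + (-1) * psi y).
  have c2 := jet_cont (jetZ (-1) Jq).
  by move=> y; apply: (@continuousD R R^o _ G); [exact: Gc|exact: c2].
have ball0 : [set y | `|y - y0| <= rho] !=set0.
  by exists y0; rewrite /= subrr normr0 ltW.
have [y1 y1B y1max] := compact_EVT_max ball0 (@closed_ball_compact _ _ y0 rho)
  (continuous_subspaceT thc).
rewrite inE /= in y1B.
have y1r : `|y1 - y0| < rho.
  have := y1max y0; rewrite inE /= subrr normr0 => /(_ (ltW rho0)).
  rewrite /psi subrr sqn0.
  have := MFd y0; have := MFd y1; rewrite !ler_norml => h1 h2 h3.
  have h5 := FGle y1.
  have h4 : sg * sqn (y1 - y0) <= 2 * ep by lra.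
  rewrite -(@ltr_pXn2r _ 2) ?nnegrE// ?(ltW rho0)//.
  apply: le_lt_trans (norm_sqn _) _.
  rewrite -(ltr_pM2l sg0); apply: le_lt_trans h4 _.
  have : 0 < sg * rho ^+ 2 by rewrite mulr_gt0// exprn_gt0.
  rewrite /ep; lra.
set t := G y1 + (-1) * psi y1 in y1max.
have Jpsi := jetD Jq (jet_affine 0 t).
have [z Kz zy] := vG.2 y1.
have [zK vz Hz] := locG z y1 Kz zy ltac:(lra).
have [||c' [T [gT [XT [JT Tz nT gTE XTE]]]]] := touch_transfer vG zK zy Jpsi.
- by rewrite /= dot0l /t; ring.
- have : \forall y' \near y1, `|y' - y1| < rho - `|y1 - y0| by apply: near_norm; lra.
  apply: filterS => y' yy'; rewrite dot0l.
  have : G y' + (-1) * psi y' <= t.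
    by apply: y1max; rewrite inE /= -(subrKA y1) (le_trans (ler_normD _ _))//; lra.
  lra.
have JN := jetZ (-1) JT.
have tb : touches_below (fun x => -1 * T x) v z.
  split; first by rewrite Tz; ring.
  by apply: filterS nT => z'; lra.
have := v_super (KO Kz) JN tb.
rewrite /Emu gTE.
(* The frame is chosen only now, adapted to the Hessian of the test function at [z]. *)
have [a aa <-] := Pminus_attained (jet_sym JN z) kN.
have sa l : sqn (a l) = 1 by rewrite /sqn aa eqxx.
rewrite lapZ XTE !lapD !lapZ !lap_scalar//.
have [_ cX] : `|y1 - y0| + 2 * N%:R * d < r1 / 2 /\ c <= lap a (X y1).
  have y1d : `|y1 - y0| + 2 * N%:R * d < r1 / 2 by lra.
  split=> //.
  exact: (moll_visc k_gt0 sa L0 FL' Fm r10' (F_visc a aa) d0 J y1d).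
have l0 : lap a 0 = 0 by rewrite -(scale0r 0) lapZ mul0r.
rewrite l0.
have vz' : `|v z - v z0| <= e1 by rewrite -normrN; move: vz; congr (`|_| <= _); ring.
have := e1m _ _ _ m2q vz'.
rewrite /c in cX.
move: Hz; rewrite !ler_norml; lra.
Qed.

End Doubled.

End Comparison.

Lemma enorm_le (R : realType) (N : nat) (x : 'rV[R]_N) : enorm x <= (N%:R + 1) * `|x|.
Proof.
rewrite -(@ler_pXn2r _ 2) ?nnegrE ?enorm_ge0 ?mulr_ge0 ?addr_ge0//.
rewrite enorm_sqn; apply: le_trans (ler_norm _) _; apply: le_trans (dot_le _ _) _.
have h0 : 0 <= `|x| * `|x| by rewrite mulr_ge0.
have h1 : 0 <= N%:R * (`|x| * `|x|) by rewrite mulr_ge0.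
have h2 : 0 <= N%:R * N%:R * (`|x| * `|x|) by rewrite !mulr_ge0.
have -> : ((N%:R + 1) * `|x|) ^+ 2 =
  N%:R * N%:R * (`|x| * `|x|) + 2 * (N%:R * (`|x| * `|x|)) + `|x| * `|x| by ring.
lra.
Qed.

(** * Exclusion of contact points, and positive homogeneity *)

Section Comparison.
Variables (R : realType) (N k : nat) (Omega : set 'rV[R]_N)
    (H : 'rV[R]_N -> 'rV[R]_N -> R).
Hypothesis kN : (0 < k <= N)%N.
Hypothesis Omega_open : open Omega.
Hypothesis H_cont : {within Omega `*` setT,
                 continuous (fun z : 'rV[R]_N * 'rV[R]_N => H z.1 z.2)}.
Hypothesis H_hom : forall x (t : R) xi, Omega x -> 0 < t ->
               H x (t *: xi) = t * H x xi.
Hypothesis H_mod : exists2 omega : R -> R, modulus_of_continuity omega &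
               forall x y xi, Omega x -> Omega y ->
                 `|H x xi - H y xi| <= omega (enorm (x - y) * (1 + enorm xi)).

(** A single large [al] suffices, without a limit. The gap is assumed for pairs because the doubled
    maximum need not lie on the diagonal; the modulus of [H] and the doubled inequality lose
    [kap / 4] each, against a gap of [kap]. *)
Lemma no_contact (u v : 'rV[R]_N -> R) (mu1 mu2 kap eta : R) (K : set 'rV[R]_N)
    (x1 : 'rV[R]_N) :
  jet_subsolution (Emu k H mu1) Omega u -> jet_supersolution (Emu k H mu2) Omega v ->
  compact K -> K `<=` Omega -> usc_in K u -> usc_in K (fun x => - v x) ->
  (forall x, K x -> u x <= v x) -> (forall x, K x -> u x = v x -> nbhs x K) ->
  0 < kap -> 0 < eta ->
  (forall x z, K x -> K z -> 0 <= u x - v z -> u x - v z <= eta ->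
     mu1 * u x - mu2 * v z <= - kap) ->
  K x1 -> u x1 = v x1 -> False.
Proof.
move=> u_sub v_super cK KO uu vv uv contact kap0 eta0 gap Kx1 uvx1.
have [omega [om0 om_mono om00 om_cvg] Hmod] := H_mod.
have kap40 : 0 < kap / 4 by rewrite divr_gt0.
have [s0 s00 oms] : exists2 s, 0 < s & omega s <= kap / 4.
  have /cvgrPdist_lt/(_ _ kap40) := om_cvg.
  move=> [d /= d0 dom]; exists (d / 2); first by rewrite divr_gt0.
  have := dom (d / 2); rewrite /ball_ /= !sub0r !normrN.
  rewrite (gtr0_norm (_ : 0 < d / 2)) ?divr_gt0// => /(_ _ _)/wrap[||].
  - lra.
  - by [].
  - by move=> h; apply/ltW/(le_lt_trans (ler_norm _)).
(* With p = 2 al (x0 - z0) the argument of [omega] is |x0 - z0| + 2 al |x0 - z0|^2, where |x0 - z0|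
   and al |x0 - z0|^2 will both be at most [s0 / 4]. *)
pose eta1 := Num.min eta (s0 / 4).
have eta10 : 0 < eta1 by rewrite lt_min eta0 divr_gt0.
have [eta1e eta1s] : eta1 <= eta /\ eta1 <= s0 / 4 by rewrite !ge_min !lexx orbT.
pose W := [set p : 'rV[R]_N * 'rV[R]_N | [/\ nbhs p.1 K, nbhs p.2 K,
  u p.1 - v p.2 <= eta1 & enorm (p.1 - p.2) <= s0 / 4]].
have [|al al0 alW] := @penalization R N K u v W cK uu vv.
  move=> x Kx uvx0.
  have uvx : u x = v x by have := uv x Kx; lra.
  have xK := contact x Kx uvx.
  have e20 : 0 < eta1 / 2 by rewrite divr_gt0.
  have [V1 xV1 h1] := uu x Kx _ e20; have [V2 xV2 h2] := vv x Kx _ e20.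
  pose dl := s0 / 4 / (N%:R + 1) / 2.
  have N10 : 0 < N%:R + 1 :> R by rewrite ltr_wpDl.
  have dl0 : 0 < dl by rewrite !divr_gt0.
  have dlE : (N%:R + 1) * (2 * dl) = s0 / 4 by rewrite /dl; field; lra.
  pose U := [set y : 'rV[R]_N | `|y - x| < dl].
  have xU : nbhs x U := near_norm x dl0.
  have xI : nbhs x (interior K) by exact: nbhs_interior.
  exists ((V1 `&` (U `&` interior K)) `*` (V2 `&` (U `&` interior K))).
    exists (V1 `&` (U `&` interior K), V2 `&` (U `&` interior K)) => //=.
    by split; do ! apply: filterI.
  move=> [y z] /= Ky Kz [[V1y [Uy Iy]] [V2z [Uz Iz]]]; split => //=.
    have := h1 y Ky V1y; have := h2 z Kz V2z; lra.
  apply: le_trans (enorm_le _) _; rewrite -dlE ler_wpM2l// ?ltW//.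
  rewrite /U /= in Uy Uz; rewrite (distrC z) in Uz.
  have := ler_distD x y z; lra.
have uscuv : forall p, (K `*` K) p -> forall e, 0 < e ->
    exists2 V, nbhs p V & forall q, (K `*` K) q -> V q ->
      u q.1 - v q.2 - al * sqn (q.1 - q.2) < u p.1 - v p.2 - al * sqn (p.1 - p.2) + e.
  move=> [x z] [/= Kx Kz] e e0; have e30 : 0 < e / 3 by rewrite divr_gt0.
  have [V1 xV1 h1] := uu x Kx _ e30; have [V2 zV2 h2] := vv z Kz _ e30.
  have c1 : continuous (fun y : 'rV[R]_N => al * sqn y).
    exact: (jet_cont (jetZ al (jet_sqn R N))).
  have /cvgrPdist_lt/(_ _ e30)/nbhs_ballP[d d0 dA] := c1 (x - z).
  have d20 : 0 < d / 2 by rewrite divr_gt0.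
  exists ((V1 `&` [set y | `|y - x| < d / 2]) `*` (V2 `&` [set y | `|y - z| < d / 2])).
    exists (V1 `&` [set y | `|y - x| < d / 2], V2 `&` [set y | `|y - z| < d / 2]) => //=.
    by split; apply: filterI => //; [exact: (near_norm x d20)|exact: (near_norm z d20)].
  move=> [x' z'] [/= Kx' Kz'] [[/= /(h1 _ Kx') ? xx'] [/(h2 _ Kz') ? zz']].
  have : `|al * sqn (x - z) - al * sqn (x' - z')| < e / 3.
    apply: dA; rewrite -ball_normE /=.
    have -> : x - z - (x' - z') = - (x' - x) + (z' - z).
      by rewrite !opprB addrACA [RHS]addrACA (addrC (- z)).
    by rewrite (le_lt_trans (ler_normD _ _))// normrN; lra.
  rewrite ltr_norml; lra.
have [[x0 z0] [/= Kx0 Kz0] xzmax] :=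
  usc_max (compact_setX cK cK) (ex_intro _ (x1, x1) (conj Kx1 Kx1)) uscuv.
have pos : 0 <= u x0 - v z0 - al * sqn (x0 - z0).
  have := xzmax (x1, x1) (conj Kx1 Kx1); rewrite /= subrr sqn0 uvx1; lra.
have [/= x0K z0K uve xze] := alW (x0, z0) Kx0 Kz0 pos.
have al40 : 0 < 4 * al by rewrite mulr_gt0.
have key := doubled_ineq kN Omega_open H_cont u_sub v_super cK KO uu vv al40 kap40 x0K z0K.
have al4 : 4 * al / 4 = al by field.
have al2 : 4 * al / 2 = 2 * al by field.
rewrite al4 al2 in key.
have {key} := key (fun x z Kx Kz => xzmax (x, z) (conj Kx Kz)).
set p := (2 * al) *: (x0 - z0).
have as0 : 0 <= al * sqn (x0 - z0) by rewrite mulr_ge0 ?sqn_ge0// ltW.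
have g := gap x0 z0 Kx0 Kz0 ltac:(lra) ltac:(lra).
have : `|H x0 p - H z0 p| <= kap / 4.
  apply: le_trans (Hmod _ _ p (KO _ Kx0) (KO _ Kz0)) _; apply: le_trans oms.
  apply: om_mono; first by rewrite mulr_ge0 ?addr_ge0 ?enorm_ge0.
  rewrite /p enormZ gtr0_norm ?mulr_gt0// mulrDr mulr1 mulrCA -expr2 enorm_sqn; lra.
rewrite ler_norml; lra.
Qed.

Lemma PminusZ c (X : 'M[R]_N) : 0 < c -> X^T = X -> Pminus k (c *: X) = c * Pminus k X.
Proof.
have h d (Y : 'M[R]_N) : 0 < d -> Y^T = Y -> Pminus k (d *: Y) <= d * Pminus k Y.
  move=> d0 Ys; have [a aa <-] := Pminus_attained Ys kN.
  rewrite -lapZ; apply: Pminus_le_lap => //.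
  by rewrite linearZ /= Ys.
move=> c0 Xs; apply/eqP; rewrite eq_le h//=.
have cXs : (c *: X)^T = c *: X by rewrite linearZ /= Xs.
have := h c^-1 (c *: X); rewrite invr_gt0 => /(_ c0 cXs).
rewrite scalerA mulVf ?gt_eqF// scale1r => hh.
by rewrite -ler_pdivlMl.
Qed.

Lemma EmuZ mu c x r p (X : 'M[R]_N) : 0 < c -> Omega x -> X^T = X ->
  Emu k H mu x (c * r) (c *: p) (c *: X) = c * Emu k H mu x r p X.
Proof. by move=> c0 Ox Xs; rewrite /Emu PminusZ// H_hom//; ring. Qed.

Lemma jet_subsolutionZ mu c w : 0 < c ->
  jet_subsolution (Emu k H mu) Omega w ->
  jet_subsolution (Emu k H mu) Omega (fun x => c * w x).
Proof.
move=> c0 ws x C phi g X Ox J [phix nphi].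
have ci0 : 0 < c^-1 by rewrite invr_gt0.
have cn0 : c != 0 by rewrite gt_eqF.
have t : touches_above (fun y => c^-1 * phi y) w x.
  split; first by rewrite phix mulKf.
  by apply: filterS nphi => y; rewrite ler_pdivlMl.
have := ws x _ _ _ _ Ox (jetZ c^-1 J) t.
by rewrite -{1}(mulKf cn0 (w x)) EmuZ ?(jet_sym J)// pmulr_rge0.
Qed.

Lemma jet_supersolutionZ mu c w : 0 < c ->
  jet_supersolution (Emu k H mu) Omega w ->
  jet_supersolution (Emu k H mu) Omega (fun x => c * w x).
Proof.
move=> c0 ws x C phi g X Ox J [phix nphi].
have ci0 : 0 < c^-1 by rewrite invr_gt0.
have cn0 : c != 0 by rewrite gt_eqF.
have t : touches_below (fun y => c^-1 * phi y) w x.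
  split; first by rewrite phix mulKf.
  by apply: filterS nphi => y; rewrite ler_pdivrMl.
have := ws x _ _ _ _ Ox (jetZ c^-1 J) t.
by rewrite -{1}(mulKf cn0 (w x)) EmuZ ?(jet_sym J)// pmulr_rle0.
Qed.

End Comparison.

(** * Reduction to a contact point *)

Lemma lsc_on_usc_in (R : realType) (N : nat) (A K : set 'rV[R]_N) (u : 'rV[R]_N -> R) :
  K `<=` A -> lsc_on A u -> usc_in K (fun x => - u x).
Proof.
move=> KA ul x Kx e e0.
have [|V xV Vu] := ul x (u x - e); first by rewrite lte_fin; lra.
exists [set y | A y -> V y]; last first.
  by move=> y Ky /(_ (KA _ Ky))/Vu; rewrite lte_fin; lra.
by move: xV; rewrite /nbhs /= -nbhs_subspace_in//; exact: KA.
Qed.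

Lemma usc_on_usc_in (R : realType) (N : nat) (A K : set 'rV[R]_N) (u : 'rV[R]_N -> R) :
  K `<=` A -> usc_on A u -> usc_in K u.
Proof.
move=> KA /(lsc_on_usc_in KA) h x Kx e e0.
have [V xV Vu] := h x Kx e e0; exists V => // y Ky /(Vu y Ky); lra.
Qed.

Lemma limf_esup_to_boundary (R : realType) (N : nat) (Omega : set 'rV[R]_N)
    (u : 'rV[R]_N -> R) :
  (limf_esup (fun x => (u x)%:E) (to_boundary Omega) <= 0)%E ->
  forall e, 0 < e -> exists2 d, 0 < d & forall x y, Omega x -> boundary Omega y ->
    `|x - y| < d -> u x < e.
Proof.
move=> h e e0.
have : (limf_esup (fun x => (u x)%:E) (to_boundary Omega) < e%:E)%E.
  by apply: le_lt_trans h _; rewrite lte_fin.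
move=> /ereal_inf_lt[_ [A [d d0 dA] <-] supA].
have N10 : 0 < N%:R + 1 :> R by rewrite ltr_wpDl.
exists (d / (N%:R + 1)); first by rewrite divr_gt0.
move=> x y Ox By xy; rewrite -lte_fin; apply: le_lt_trans supA.
apply: ereal_sup_ubound; exists x => //; apply: (dA x y) => //.
apply: le_lt_trans (enorm_le _) _.
by rewrite mulrC -ltr_pdivlMr.
Qed.

Lemma closure_compact (R : realType) (N : nat) (Omega : set 'rV[R]_N) :
  bounded_set Omega -> compact (closure Omega).
Proof.
move=> [M [_ MO]].
have cB := @closed_ball_compact R N 0 (M + 1).
apply: (subclosed_compact _ cB); first exact: closed_closure.
have clB : closed [set x : 'rV[R]_N | `|x - 0| <= M + 1].
  by apply: compact_closed => //; exact: norm_hausdorff.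
rewrite [X in _ `<=` X](closure_id _).1//; apply: closureS => x Ox /=.
by rewrite subr0; apply: MO => //; rewrite ltrDl.
Qed.

(** The positive part matters: for a negative numerator, division by a lower semicontinuous function
    need not be upper semicontinuous. *)
Lemma usc_in_ratio (R : realType) (N : nat) (K : set 'rV[R]_N) (u w : 'rV[R]_N -> R) :
  usc_in K u -> usc_in K (fun x => - w x) -> (forall x, K x -> 0 < w x) ->
  usc_in K (fun x => Num.max (u x) 0 / w x).
Proof.
move=> uu ww w0 x Kx e e0.
set m := Num.max (u x) 0; have wx := w0 x Kx.
have m0 : 0 <= m by rewrite le_max lexx orbT.
set r := m / w x; have r0 : 0 <= r by rewrite divr_ge0// ltW.
(* Chosen so that [(r + e) * (w x - d)] exceeds [m + d]. *)
pose d := w x * e / (2 * (1 + r + e)).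
have q0 : 0 < 2 * (1 + r + e) by rewrite mulr_gt0//; lra.
have d0 : 0 < d by rewrite divr_gt0// mulr_gt0.
have dE : d * (1 + r + e) = w x * e / 2.
  by rewrite /d; field; rewrite gt_eqF//; lra.
have dw : d < w x.
  rewrite /d ltr_pdivrMr// ltr_pM2l//; lra.
have [V1 xV1 h1] := uu x Kx d d0; have [V2 xV2 h2] := ww x Kx d d0.
exists (V1 `&` V2); first exact: filterI.
move=> y Ky [/(h1 y Ky) uy /(h2 y Ky) wy].
have wy0 := w0 y Ky.
rewrite ltr_pdivrMr//.
have mx : u x <= m by rewrite le_max lexx.
have rm : r * w x = m by rewrite /r divfK// gt_eqF.
have re0 : 0 < r + e by lra.
have h : (r + e) * (w x - d) < (r + e) * w y by rewrite ltr_pM2l//; lra.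
have we : 0 < w x * e by rewrite mulr_gt0.
rewrite gt_max; apply/andP; split; lra.
Qed.

(** The factor is the maximum of the ratio of the positive part of [u] to [w] over a compact set
    away from the boundary. Positivity and semicontinuity of [w] up to the boundary give a positive
    lower bound for [w], so [u] is too small for contact near the boundary. *)
Lemma touching_multiple (R : realType) (N : nat) (Omega : set 'rV[R]_N)
    (u w : 'rV[R]_N -> R) (x1 : 'rV[R]_N) :
  open Omega -> bounded_set Omega -> (forall x, closure Omega x -> 0 < w x) ->
  usc_in (closure Omega) (fun x => - w x) -> usc_in Omega u ->
  (limf_esup (fun x => (u x)%:E) (to_boundary Omega) <= 0)%E ->
  Omega x1 -> 0 < u x1 ->
  exists K c g x2, [/\ compact K, K `<=` Omega, 0 < c, 0 < g & K x2] /\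
    [/\ forall x, K x -> c <= g * w x, forall x, K x -> u x <= g * w x,
        forall x, K x -> u x = g * w x -> nbhs x K & u x2 = g * w x2].
Proof.
move=> oO bO w0 ww uu ub Ox1 ux1.
have cO := closure_compact bO.
have clO : Omega `<=` closure Omega by exact: subset_closure.
have w10 := w0 _ (clO _ Ox1).
have [xm Oxm wm] := usc_max cO (ex_intro _ x1 (clO _ Ox1)) ww.
pose b := u x1 / w x1; pose c0 := w xm.
have b0 : 0 < b by rewrite divr_gt0.
have c00 : 0 < c0 by exact: w0.
have c0w x : closure Omega x -> c0 <= w x by move=> /wm; rewrite lerN2.
(* As g >= b, contact forces u >= b c0; half of this is a level below which [u] stays within
   distance [d] of the boundary. *)
have bc0 : 0 < b * c0 / 2 by rewrite divr_gt0// mulr_gt0.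
have [d d0 strip] := limf_esup_to_boundary ub bc0.
pose A t := [set x | closure Omega x /\ forall y, boundary Omega y -> t <= `|x - y|].
have AO t : 0 < t -> A t `<=` Omega.
  move=> t0 x [clx far]; apply: contrapT => nO.
  have : t <= `|x - x|.
    by apply: far; split => //; move/(@interior_subset _ Omega).
  by rewrite subrr normr0 leNgt t0.
have cA t : compact (A t).
  apply: (subclosed_compact _ cO); last by move=> x [].
  have -> : A t = closure Omega `&`
      \bigcap_(y in boundary Omega) [set x | t <= `|x - y|].
    by apply/seteqP; split => x [? h]; split.
  apply: closedI; first exact: closed_closure.
  apply: closed_bigI => y _.
  have cN : continuous (fun x : 'rV[R]_N => `|x - y|).
    apply: (@lip_continuous _ _ 1) => // x x'; rewrite mul1r.
    by apply: le_trans (ler_dist_dist _ _) _; rewrite opprB addrA subrK.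
  exact: (preimage_closed (fun x _ => cN x) (@closed_ge R t)).
have inA t x : t <= d -> Omega x -> b * c0 / 2 <= u x -> A t x.
  move=> td Ox ux; split; first exact: clO.
  move=> y By; rewrite leNgt; apply/negP => xy.
  have := strip x y Ox By (lt_le_trans xy td).
  by rewrite ltNge ux.
have d20 : 0 < d / 2 by rewrite divr_gt0.
have d2d : d / 2 <= d by lra.
(* The ratio is maximized at distance at least [d / 2] from the boundary, while contact occurs only
   at distance at least [d]; the difference makes contact points interior to the compact set. *)
have cK := cA (d / 2); have KO := AO _ d20.
have Kcl : A (d / 2) `<=` closure Omega by move=> x [].
have wK : usc_in (A (d / 2)) (fun x => - w x).
  move=> x /Kcl Kx e e0; have [V xV Vw] := ww x Kx e e0.
  by exists V => // y /Kcl; exact: Vw.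
have uK : usc_in (A (d / 2)) u.
  move=> x /KO Kx e e0; have [V xV Vw] := uu x Kx e e0.
  by exists V => // y /KO; exact: Vw.
have bE : u x1 = b * w x1 by rewrite /b divfK// gt_eqF.
have Kx1 : A (d / 2) x1.
  apply: inA => //; rewrite bE.
  have := ler_wpM2l (ltW b0) (c0w _ (clO _ Ox1)).
  have : 0 < b * c0 by rewrite mulr_gt0.
  lra.
have [x2 Kx2 rmax] := usc_max cK (ex_intro _ x1 Kx1)
  (usc_in_ratio uK wK (fun x Kx => w0 x (Kcl x Kx))).
set g := Num.max (u x2) 0 / w x2 in rmax.
have bg : b <= g.
  apply: le_trans (rmax x1 Kx1).
  by rewrite /b ler_pM2r ?invr_gt0// le_max lexx.
have g0 : 0 < g by exact: lt_le_trans bg.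
have w20 := w0 _ (Kcl _ Kx2).
have gE : Num.max (u x2) 0 = g * w x2 by rewrite /g divfK// gt_eqF.
have gcw x : A (d / 2) x -> g * c0 <= g * w x.
  by move=> /Kcl/c0w; rewrite ler_pM2l.
exists (A (d / 2)), (g * c0), g, x2; split; first by split => //; exact: mulr_gt0.
split => //.
- move=> x Kx; have wx := w0 _ (Kcl _ Kx).
  have := rmax x Kx; rewrite ler_pdivrMr//; apply: le_trans.
  by rewrite le_max lexx.
- move=> x Kx ux.
  have [_ far] : A d x.
    apply: inA => //; first exact: KO.
    rewrite ux; apply: le_trans (gcw x Kx).
    have := ler_wpM2r (ltW c00) bg.
    have : 0 < b * c0 by rewrite mulr_gt0.
    lra.
  have Ox : nbhs x Omega by apply: open_nbhs_nbhs; split => //; exact: KO.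
  apply: filterS2 Ox (near_norm x d20) => y Oy yx; split; first exact: clO.
  move=> z Bz; have := far z Bz; have := ler_distD y x z.
  rewrite (distrC x y); lra.
- have gw : 0 < g * w x2 by rewrite mulr_gt0.
  by move: gE gw; case: (leP (u x2) 0) => // _ <-; rewrite ltxx.
Qed.

(** The left side is mu1 (s - t) - (mu2 - mu1) t; the second term is at most - c (mu2 - mu1), of
    which the first consumes at most half. *)
Lemma gap_arith (R : realType) (mu1 mu2 c eta s t : R) : 0 <= eta ->
  `|mu1| * eta <= c * (mu2 - mu1) / 2 -> mu1 < mu2 -> c <= t ->
  0 <= s - t -> s - t <= eta ->
  mu1 * s - mu2 * t <= - (c * (mu2 - mu1) / 2).
Proof.
move=> eta0 h mu12 ct st0 st.
have h1 : mu1 * (s - t) <= `|mu1| * eta.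
  apply: le_trans (ler_norm _) _; rewrite normrM (ger0_norm st0).
  by rewrite ler_wpM2l.
have h2 : 0 <= (mu2 - mu1) * (t - c) by rewrite mulr_ge0 ?subr_ge0// ltW.
lra.
Qed.

Unset Implicit Arguments.

Theorem theorem4p1 (R : realType) (N k : nat) (Omega : set 'rV[R]_N)
    (H : 'rV[R]_N -> 'rV[R]_N -> R)
    (hN : (2 <= N)%N) (hk : (1 <= k < N)%N)
    (Omega_open : open Omega) (Omega_connected : connected Omega)
    (Omega_nonempty : Omega !=set0) (Omega_bounded : bounded_set Omega)
    (H_cont : {within Omega `*` setT,
                 continuous (fun z : 'rV[R]_N * 'rV[R]_N => H z.1 z.2)})
    (H_hom : forall x (t : R) xi, Omega x -> 0 < t ->
               H x (t *: xi) = t * H x xi)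
    (H_mod : exists2 omega : R -> R, modulus_of_continuity omega &
               forall x y xi, Omega x -> Omega y ->
                 `|H x xi - H y xi| <= omega (enorm (x - y) * (1 + enorm xi))) :
  (forall mu : R, (mu%:E < mubar_minus k H Omega)%E ->
     minimum_principle (Emu k H mu) Omega) /\
  (forall mu : R, (mu%:E < mubar_plus k H Omega)%E ->
     maximum_principle (Emu k H mu) Omega).
Proof.
have kN : (0 < k <= N)%N by case/andP: hk => -> /ltnW.
have clO : Omega `<=` closure Omega by exact: subset_closure.
have eta_ex (mu c d : R) : 0 < c -> 0 < d ->
    exists2 eta, 0 < eta & `|mu| * eta <= c * d / 2.
  move=> c0 d0; have m1 : 0 < `|mu| + 1 by rewrite ltr_wpDl.
  have cd : 0 < c * d / 2 by rewrite divr_gt0// mulr_gt0.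
  exists (c * d / 2 / (`|mu| + 1)); first by rewrite divr_gt0.
  by rewrite mulrA ler_pdivrMr// mulrC ler_pM2l// lerDl.
split=> mu /ereal_sup_gt[_ [mu' [w [w0 w_sc w_sol]] <-]]; rewrite lte_fin => mumu'.
(* Negation would turn the sum of the smallest eigenvalues into that of the largest, so this is not
   the other part for - u. The multiple is found for - u and - w, but in the comparison g w is the
   subsolution, with the larger parameter [mu'], and u the supersolution. *)
- move=> u u_super u_bd x1 Ox1; rewrite leNgt; apply/negP => ux1.
  have u_bd' : (limf_esup (fun x => (- u x)%:E) (to_boundary Omega) <= 0)%E.
    by move: u_bd; rewrite /limf_einf oppe_ge0.
  have [||||K [c [g [x2 [[cK KO c0 g0 Kx2] [cw le ct eq]]]]]] :=
    @touching_multiple R N Omega (fun x => - u x) (fun x => - w x) x1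
      Omega_open Omega_bounded _ _ _ u_bd' Ox1 _.
  + by move=> x /w0; rewrite oppr_gt0.
  + move=> x Kx e e0; have [V xV Vw] := usc_on_usc_in (@subset_refl _ _) w_sc Kx e0.
    by exists V => // y Ky /(Vw y Ky); rewrite !opprK.
  + exact: lsc_on_usc_in u_super.1.
  + by rewrite oppr_gt0.
  have dmu : 0 < mu' - mu by lra.
  have [eta eta0 etaE] := eta_ex mu c _ c0 dmu.
  have Kcl x : K x -> closure Omega x by move=> /KO/clO.
  apply: (@no_contact R N k Omega H kN Omega_open H_cont H_mod (fun x => g * w x) u mu' mu
    (c * (mu' - mu) / 2) eta K x2 _ _ cK KO) => //.
  + exact: (jet_subsolutionZ kN H_hom g0 (subsolution_jet w_sol)).
  + exact: supersolution_jet.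
  + move=> x Kx e e0; have e'0 : 0 < e / g by rewrite divr_gt0.
    have [V xV Vw] := usc_on_usc_in Kcl w_sc Kx e'0.
    exists V => // y Ky /(Vw y Ky); rewrite -(ltr_pM2l g0) mulrDr.
    by rewrite (mulrC g (e / g)) divfK// gt_eqF.
  + exact: lsc_on_usc_in u_super.1.
  + by move=> x /le; lra.
  + by move=> x Kx E; apply: ct => //; lra.
  + by rewrite divr_gt0// mulr_gt0.
  + move=> x z Kx Kz h1 h2.
    have := @gap_arith R mu mu' c eta (- u z) (- (g * w x)) (ltW eta0) etaE mumu'.
    have := cw x Kx; lra.
  + lra.
- move=> u u_sub u_bd x1 Ox1; rewrite leNgt; apply/negP => ux1.
  have ww : usc_in (closure Omega) (fun x => - w x) by exact: lsc_on_usc_in w_sc.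
  have [|K [c [g [x2 [[cK KO c0 g0 Kx2] [cw le ct eq]]]]]] :=
    touching_multiple Omega_open Omega_bounded w0 ww _ u_bd Ox1 ux1.
    exact: usc_on_usc_in u_sub.1.
  have dmu : 0 < mu' - mu by lra.
  have [eta eta0 etaE] := eta_ex mu c _ c0 dmu.
  have Kcl x : K x -> closure Omega x by move=> /KO/clO.
  apply: (@no_contact R N k Omega H kN Omega_open H_cont H_mod u (fun x => g * w x) mu mu'
    (c * (mu' - mu) / 2) eta K x2 _ _ cK KO) => //.
  + exact: subsolution_jet.
  + exact: (jet_supersolutionZ kN H_hom g0 (supersolution_jet w_sol)).
  + exact: usc_on_usc_in u_sub.1.
  + move=> x Kx e e0; have e'0 : 0 < e / g by rewrite divr_gt0.
    have [V xV Vw] := lsc_on_usc_in Kcl w_sc Kx e'0.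
    exists V => // y Ky /(Vw y Ky); rewrite -(ltr_pM2l g0) mulrDr !mulrN.
    by rewrite (mulrC g (e / g)) divfK// gt_eqF.
  + by rewrite divr_gt0// mulr_gt0.
  + by move=> x z Kx Kz h1 h2; apply: (gap_arith (ltW eta0)) => //; exact: cw.
Qed.
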